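(* Let $\mathbb I=[0,1]$, let $\mathcal M$ be the ideal of meager subsets of the Hilbert cube $\mathbb I^\omega$, let $\mathcal C_0$ be the family of all minimal Cantor sets in $\mathbb I^\omega$, and let $\sigma\mathcal C_0$ be the $\sigma$-ideal generated by $\mathcal C_0$. Then: (1) $\mathrm{cov}(\sigma\mathcal C_0)=\mathrm{cov}(\mathcal M)$; (2) $\mathrm{non}(\sigma\mathcal C_0)=\mathrm{non}(\mathcal M)$; (3) $\mathrm{add}(\sigma\mathcal C_0,\mathcal M)=\mathrm{add}(\mathcal M)$; (4) $\mathrm{cof}(\sigma\mathcal C_0,\mathcal M)=\mathrm{cof}(\mathcal M)$.
   Context: The $\sigma$-ideal generated by a family $\mathcal F$ consists of all subsets of countable unions of sets from $\mathcal F$. A Cantor set in $\mathbb I^\omega$ is a subset homeomorphic to $\{0,1\}^\omega$; a Cantor set $A\subseteq\mathbb I^\omega$ is minimal if for each Cantor set $B\subseteq\mathbb I^\omega$ there is a homeomorphism $h:\mathbb I^\omega\to\mathbb I^\omega$ with $h(A)\subseteq B$. For an ideal $\mathcal I$ on a set $X=\bigcup\mathcal I\notin\mathcal I$: $\mathrm{add}(\mathcal I)=\min\{|\mathcal A|:\mathcal A\subseteq\mathcal I,\ \bigcup\mathcal A\notin\mathcal I\}$, $\mathrm{non}(\mathcal I)=\min\{|A|:A\subseteq X,\ A\notin\mathcal I\}$, $\mathrm{cov}(\mathcal I)=\min\{|\mathcal A|:\mathcal A\subseteq\mathcal I,\ \bigcup\mathcal A=X\}$, $\mathrm{cof}(\mathcal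 I)=\min\{|\mathcal A|:\mathcal A\subseteq\mathcal I,\ \forall B\in\mathcal I\ \exists A\in\mathcal A\ (B\subseteq A)\}$. For ideals $\mathcal I\subseteq\mathcal J$: $\mathrm{add}(\mathcal I,\mathcal J)=\min\{|\mathcal A|:\mathcal A\subseteq\mathcal I,\ \bigcup\mathcal A\notin\mathcal J\}$ and $\mathrm{cof}(\mathcal I,\mathcal J)=\min\{|\mathcal A|:\mathcal A\subseteq\mathcal J,\ \forall B\in\mathcal I\ \exists A\in\mathcal A\ (B\subseteq A)\}$. *)

(* Defs.v *)
From HB Require Import structures.
From mathcomp Require Import all_boot all_order all_algebra.
From mathcomp Require Import all_classical all_reals all_analysis.

Set Implicit Arguments.
Unset Strict Implicit.
Unset Printing Implicit Defensive.

Import Order.TTheory GRing.Theory Num.Theory.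
Import numFieldNormedType.Exports.

Local Open Scope classical_set_scope.
Local Open Scope ring_scope.
Local Open Scope card_scope.

Definition homeomorphism (T U : topologicalType) (f : T -> U) : Prop :=
  continuous f /\
  exists g : U -> T, [/\ continuous g, cancel f g & cancel g f].

Definition homeomorphic (T U : topologicalType) : Prop :=
  exists f : T -> U, homeomorphism f.

Definition nowhere_dense (T : topologicalType) (A : set T) : Prop :=
  (closure A)° = set0.

Definition meager (T : topologicalType) : set (set T) :=
  [set A | exists2 F : nat -> set T,
             (forall n, nowhere_dense (F n)) & A = \bigcup_n F n].

Definition sigma_ideal (T : Type) (F : set (set T)) : set (set T) :=
  [set A | exists2 G : set (set T),
             countable G /\ G `<=` F & A `<=` \bigcup_(B in G) B].

(* A cardinal number is represented by a set of that cardinality, to be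
   compared with [#=] and [#<=] only: [min_card P] is a member of [P] of least
   cardinality ([min_cardP]). It is a junk value when [P] is empty. *)
Definition min_card (T : Type) (P : set (set T)) : set T :=
  xget set0 [set A | P A /\ forall B, P B -> A #<= B].

Lemma min_cardP (T : Type) (P : set (set T)) : P !=set0 ->
  P (min_card P) /\ forall B, P B -> min_card P #<= B.
Proof.
move=> [A1 PA1].
suff: exists A, P A /\ forall B, P B -> A #<= B by exact: xgetPex.
pose Q (S : set (set T -> T)) :=
  (forall s A, S s -> P A -> A (s A)) /\
  (forall A s t, P A -> S s -> S t -> s A = t A -> s = t).
have [|S [[SP Sinj] Smax]] := @Zorn_bigcup _ Q.
  move=> F FQ Ftot; split=> [s A [X FX Xs] PA|A s t PA [X FX Xs] [Y FY Yt]].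
    by have [FQX _] := FQ X FX; exact: FQX Xs PA.
  have [XY|YX] := Ftot _ _ FX FY => e.
    by have [_ /(_ A)] := FQ Y FY; apply => //; exact: XY.
  by have [_ /(_ A)] := FQ X FX; apply => //; exact: YX.
have [[A [PA AS]]|noA] :=
    pselect (exists A, P A /\ A `<=` [set s A | s in S]).
  exists A; split=> // B PB.
  apply: (card_le_trans (subset_card_le AS)).
  apply: (card_le_trans (card_image_le _ _)).
  have SB : [set s B | s in S] `<=` B by move=> _ [s Ss <-]; exact: SP Ss PB.
  apply: (card_le_trans _ (subset_card_le SB)).
  have : [set s B | s in S] #= S.
    apply: inj_card_eq => s t /set_mem Ss /set_mem St; exact: Sinj.
  by rewrite card_eq_le => /andP[].
have new A : P A -> exists x, A x /\ ~ [set s A | s in S] x.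
  move=> PA; apply: contrapT => H; apply: noA; exists A; split=> // x Ax.
  by apply: contrapT => nx; apply: H; exists x.
have [x1 _] := new _ PA1.
have /choice[s sP] : forall A, exists x, P A -> A x /\ ~ [set s A | s in S] x.
  move=> A; have [PA|nPA] := pselect (P A); last by exists x1.
  by have [x Hx] := new _ PA; exists x.
exfalso; apply: (Smax (S `|` [set s])).
  split=> [t St|]; first by left.
  move=> /(_ s (or_intror erefl)) Ss.
  by have [_] := sP _ PA1; apply; exists s.
split=> [t A [St|->] PA|A t u PA [St|->] [Su|->]] //.
- exact: SP St PA.
- exact: (sP A PA).1.
- exact: Sinj.
- by move=> e; have [_] := sP _ PA; case; exists t.
- by move=> e; have [_] := sP _ PA; case; exists u.
Qed.

(* Cardinal characteristics of ideals [I], [J] on the whole type [T]. *)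
Definition ideal_non (T : Type) (I : set (set T)) : set T :=
  min_card [set A : set T | ~ I A].

Definition ideal_cov (T : Type) (I : set (set T)) : set (set T) :=
  min_card [set F | F `<=` I /\ \bigcup_(A in F) A = [set: T]].

Definition ideal_add2 (T : Type) (I J : set (set T)) : set (set T) :=
  min_card [set F | F `<=` I /\ ~ J (\bigcup_(A in F) A)].

Definition ideal_cof2 (T : Type) (I J : set (set T)) : set (set T) :=
  min_card [set F | F `<=` J /\ forall B, I B -> exists2 A, F A & B `<=` A].

Definition ideal_add (T : Type) (I : set (set T)) : set (set T) := ideal_add2 I I.

Definition ideal_cof (T : Type) (I : set (set T)) : set (set T) := ideal_cof2 I I.

Definition hilbert_cube (R : realType) : Type :=
  prod_topology (fun _ : nat => `[0, 1]%classic : set R).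

HB.instance Definition _ (R : realType) := Topological.on (hilbert_cube R).

Definition cantor_set (T : topologicalType) (A : set T) : Prop :=
  homeomorphic A cantor_space.

Definition minimal_cantor_set (R : realType) : set (set (hilbert_cube R)) :=
  [set A | cantor_set A /\
     forall B : set (hilbert_cube R), cantor_set B ->
       exists2 h : hilbert_cube R -> hilbert_cube R,
         homeomorphism h & h @` A `<=` B].

(* Main.v *)
(**
Since a minimal Cantor set embeds in a nowhere dense Cantor set by a
homeomorphism of the cube, it is nowhere dense, which gives one half of each
equality.

Conversely, a product of nowhere dense compact sets containing 0 and 1 is a
minimal Cantor set.  Only a gap in each projection matters: a planar
homeomorphism [push], applied to the coordinates (0, 1), (1, 2), (2, 3), ... in
turn, uses the gap in coordinate n + 1 to move coordinate n off the end points,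
so that the set is moved into the pseudo-interior; a greedy expansion of
coordinate 0 by the others then makes coordinate 0 constant, and Klee's trick
moves the set to a standard Cantor set.  Every Cantor set contains one whose
projections have gaps, hence contains a copy of every such product.

A point of the cube is coded by the matrix of the binary digits of its
coordinates.  The points whose rows all evade a given sequence of finite binary
strings are covered by countably many products as above.  Reading the rows as
sequences of guesses, a point outside such a set guesses a prescribed sequence
infinitely often, and the classical combinatorial descriptions of cov, non, add
and cof of the meager ideal (Bartoszynski, Truss, Miller) only involve such
guesses.
*)
Require Import Defs.
From HB Require Import structures.
From mathcomp Require Import all_boot all_order all_algebra.
From mathcomp Require Import all_classical all_reals all_analysis.
From mathcomp Require Import ring lra.

Set Implicit Arguments.
Unset Strict Implicit.
Unset Printing Implicit Defensive.

Import Order.TTheory GRing.Theory Num.Theory.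
Import numFieldNormedType.Exports.

Local Open Scope classical_set_scope.
Local Open Scope ring_scope.
Local Open Scope card_scope.

(** * Cantor sets and coordinates of the Hilbert cube *)

(** A point outside a guessing set is right infinitely often, but at places that are not under
    control, so a single guess cannot both choose an interval partition and fill its intervals.
    Meager sets are therefore handled in rounds: one parameter fixes the partition, a later one
    supplies the contents. For cov the two rounds form a dichotomy: the first sets cover the cube,
    or a point missed by all of them makes the second sets cover it. For non and cof, several
    parameters are drawn from one infinite set, whence the study of squares of infinite sets. For
    add, every round is a union of few sets.

    The homeomorphisms of the cube are given by formulas in coordinates, and compactness makes the
    inverses continuous. The chain of pushes is an infinite composition without explicit inverse:
    injectivity and surjectivity have separate arguments there. *)

Section product.
Variables (I : Type) (T : I -> topologicalType).

Lemma prod_proj_continuous i : continuous (fun x : prod_topology T => x i).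
Proof.
move=> x; have /cvg_sup/(_ i) H : nbhs x --> x by [].
move=> U /(@initial_continuous (forall i, T i) (T i) (fun f => f i) x); exact: H.
Qed.

Lemma prod_continuous (S : topologicalType) (f : S -> prod_topology T) :
  (forall i, continuous (fun s => f s i)) -> continuous f.
Proof.
move=> cf s; apply/cvg_sup => i.
exact: (@continuous_comp_initial _ _ _ (fun f => f i) f (cf i)).
Qed.

End product.

Lemma set_type_compact (T : topologicalType) (K : set T) :
  compact K -> compact [set: set_type K].
Proof.
move=> cK F PF _.
have FK : (set_val @ F) K by apply: (@filterS _ F _ setT); [move=> x _; exact: set_valP|exact: filterT].
have [p [Kp clp]] := cK (set_val @ F) _ FK.
exists (exist _ p (mem_set Kp)); split => // A B FA [_ [[W oW <-] /= Wp WB]].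
have [||q [[a Aa <-] Wq]] := clp (set_val @` A) W.
- by apply: (@filterS _ F _ A) => // a Aa; exists a.
- exact: open_nbhs_nbhs.
by exists a; split => //; exact: WB.
Qed.

Lemma set_type_hausdorff (T : topologicalType) (K : set T) :
  hausdorff_space T -> hausdorff_space (set_type K).
Proof.
move=> hT x y xy; apply: val_inj; apply: hT => A B nA nB.
have [z [Az Bz]] := xy _ _ (initial_continuous nA) (initial_continuous nB).
by exists (set_val z).
Qed.

Section homeomorphisms.
Variables T U V : topologicalType.

Lemma compact_inverse_continuous (f : T -> U) (g : U -> T) :
  compact [set: T] -> hausdorff_space U -> continuous f -> cancel f g ->
  cancel g f -> continuous g.
Proof.
move=> cT hU cf fK gK; apply/continuousP => A oA.
rewrite -[A]setCK -preimage_setC openC.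
have -> : g @^-1` (~` A) = f @` (~` A).
  rewrite eqEsubset; split => [u nA|_ [t nA <-]]; last by rewrite /= fK.
  by exists (g u).
apply: compact_closed => //; apply: continuous_compact.
  exact: continuous_subspaceT.
by apply: (subclosed_compact _ cT) => //; exact: open_closedC.
Qed.

Lemma compact_homeomorphism (f : T -> U) (g : U -> T) :
  compact [set: T] -> hausdorff_space U -> continuous f -> cancel f g ->
  cancel g f -> homeomorphism f.
Proof.
move=> cT hU cf fK gK; split=> //; exists g; split=> //.
exact: (compact_inverse_continuous cT hU cf).
Qed.

Lemma homeomorphism_comp (f : T -> U) (g : U -> V) :
  homeomorphism f -> homeomorphism g -> homeomorphism (g \o f).
Proof.
move=> [cf [f' [cf' fK f'K]]] [cg [g' [cg' gK g'K]]]; split.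
  by move=> x; apply: continuous_comp; [exact: cf|exact: cg].
exists (f' \o g'); split; [|exact: can_comp|exact: can_comp].
by move=> x; apply: continuous_comp; [exact: cg'|exact: cf'].
Qed.

Lemma homeomorphism_inv (f : T -> U) : homeomorphism f ->
  exists g, [/\ homeomorphism g, cancel f g & cancel g f].
Proof. by move=> [cf [g [cg fK gK]]]; exists g; split=> //; split=> //; exists f. Qed.

End homeomorphisms.

Section cantor_sets.
Variable T : topologicalType.

Lemma range_inverse_continuous (f : cantor_space -> T) : hausdorff_space T ->
  continuous f -> injective f ->
  exists g : set_type (range f) -> cantor_space,
    [/\ continuous g, injective g & forall a, f (g a) = set_val a].
Proof.
move=> hT cf fI; pose h (c : cantor_space) : set_type (range f) :=
  exist _ (f c) (mem_set (imageT f c)).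
have ch : continuous h.
  exact: (@continuous_comp_initial _ _ _ set_val h cf).
have /choice[g gP] : forall a : set_type (range f), exists c, h c = a.
  by move=> a; have [c _ fc] := set_valP a; exists c; apply: val_inj.
have hK : cancel h g by move=> c; apply: fI; exact: (congr1 set_val (gP (h c))).
exists g; split; last by move=> a; exact: (congr1 set_val (gP a)).
  exact: (compact_inverse_continuous cantor_space_compact (set_type_hausdorff hT) ch hK gP).
exact: can_inj gP.
Qed.

Lemma cantor_set_range (f : cantor_space -> T) : hausdorff_space T ->
  continuous f -> injective f -> cantor_set (range f).
Proof.
move=> hT cf fI; have [g [cg gI fg]] := range_inverse_continuous hT cf fI.
exists g; split => //.
pose h (c : cantor_space) : set_type (range f) := exist _ (f c) (mem_set (imageT f c)).
exists h; split.
- exact: (@continuous_comp_initial _ _ _ set_val h cf).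
- by move=> a; apply: val_inj; exact: fg.
- by move=> c; apply: fI; rewrite fg.
Qed.

Lemma cantor_set_param (A : set T) : cantor_set A ->
  exists f : cantor_space -> T, [/\ continuous f, injective f & range f = A].
Proof.
move=> [g [cg [h [ch gK hK]]]]; exists (set_val \o h); split.
- move=> c; apply: continuous_comp; first exact: ch.
  exact: initial_continuous.
- by move=> c d /val_inj /(can_inj hK).
- rewrite eqEsubset; split=> [_ [c _ <-]|a Aa]; first exact: set_valP.
  by exists (g (exist _ a (mem_set Aa))) => //=; rewrite gK.
Qed.

End cantor_sets.

Section cube.
Variable R : realType.
Local Notation Q := (hilbert_cube R).

Definition coord (x : Q) (n : nat) : R := set_val (x n).

Lemma coord_itv (x : Q) n : 0 <= coord x n <= 1.
Proof. by have := set_valP (x n); rewrite /= in_itv. Qed.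

Lemma coord_inj (x y : Q) : (forall n, coord x n = coord y n) -> x = y.
Proof. by move=> xy; apply: functional_extensionality_dep => n; apply: val_inj; exact: xy. Qed.

Lemma coord_continuous n : continuous (fun x : Q => coord x n).
Proof.
move=> x; apply: (@continuous_comp _ _ _ (fun x : Q => x n) set_val).
  exact: (@prod_proj_continuous nat (fun _ => set_type (`[0, 1]%classic : set R)) n x).
exact: initial_continuous.
Qed.

Lemma cube_continuous (S : topologicalType) (f : S -> Q) :
  (forall n, continuous (fun s => coord (f s) n)) -> continuous f.
Proof.
move=> cf; apply: prod_continuous => i.
exact: (@continuous_comp_initial _ _ _ set_val (fun s => f s i) (cf i)).
Qed.

Lemma cube_hausdorff : hausdorff_space Q.
Proof.
move=> x y xy; apply: coord_inj => n; apply: (@Rhausdorff R).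
move=> A B nA nB.
have [z [Az Bz]] := xy _ _ (coord_continuous nA) (coord_continuous nB).
by exists (coord z n).
Qed.

Lemma cube_compact : compact [set: Q].
Proof.
have cI : compact [set: set_type (`[0, 1]%classic : set R)].
  exact/set_type_compact/segment_compact.
have := @tychonoff nat (fun _ => set_type (`[0, 1]%classic : set R)) (fun _ => setT) (fun _ => cI).
by congr (compact _); rewrite eqEsubset.
Qed.

Definition clip (t : R) : R := Num.min 1 (Num.max 0 t).

Lemma clip_itv t : clip t \in `[0, 1].
Proof. by rewrite in_itv /= /clip le_min ge_min le_max; lra. Qed.

(** Clipping makes [mk] total, so that continuity passes from the coordinates to the point without
    side conditions; [coord_mk] holds for values in [0, 1]. *)
Definition mk (f : nat -> R) : Q :=
  fun n => exist _ (clip (f n)) (mem_set (clip_itv (f n))).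

Lemma coord_mk f n : 0 <= f n <= 1 -> coord (mk f) n = f n.
Proof. by move=> /andP[f0 f1]; rewrite /coord /mk set_valE /= /clip; rewrite max_r // min_r. Qed.

Lemma clip_continuous : continuous clip.
Proof.
move=> t; apply: continuous_min; first exact: cst_continuous.
by apply: continuous_max; [exact: cst_continuous|exact: cvg_id].
Qed.

Lemma mk_continuous (S : topologicalType) (f : S -> nat -> R) :
  (forall n, continuous (fun s => f s n)) -> continuous (fun s => mk (f s)).
Proof.
move=> cf; apply: cube_continuous => n s.
apply: (@continuous_comp _ _ _ (fun s => f s n) clip); first exact: cf.
exact: clip_continuous.
Qed.

End cube.

(** * Homeomorphisms of an interval *)

Section slide.
Variable R : realType.
Implicit Types s t d : R.

(* Both are homeomorphisms of [[-1, 1]]: [slide s] fixes the end points and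
   moves [0] to [s]; [dilate d] fixes [-1], [0] and [1]. *)
Definition slide s t : R := t + s * (1 - `|t|).

(** [slide s] has slope [1 - s] to the right of 0 and [1 + s] to the left. One of the two summands
    always vanishes, so a single continuous formula inverts both pieces. *)
Definition slide_inv s t : R :=
  Num.max 0 (t - s) / (1 - s) + Num.min 0 (t - s) / (1 + s).

Definition dilate d t : R := t / (`|t| + d * (1 - `|t|)).

Lemma slide_norm s t : `|s| < 1 -> `|t| <= 1 -> `|slide s t| <= 1.
Proof.
rewrite /slide !ler_norml !ltr_norml => /andP[s1 s2] /andP[t1 t2].
have [t0|t0] := lerP 0 t; first by rewrite ger0_norm //; apply/andP; split; nra.
by rewrite ltr0_norm //; apply/andP; split; nra.
Qed.

Lemma slide_inv_norm s t : `|s| < 1 -> `|t| <= 1 -> `|slide_inv s t| <= 1.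
Proof.
rewrite /slide_inv !ler_norml !ltr_norml => /andP[s1 s2] /andP[t1 t2].
have [t0|t0] := lerP 0 (t - s).
  rewrite mul0r addr0 ler_pdivlMr ?ler_pdivrMr; lra.
by rewrite mul0r add0r ler_pdivlMr ?ler_pdivrMr; lra.
Qed.

Lemma slideK s : `|s| < 1 -> {in [pred t | `|t| <= 1], cancel (slide s) (slide_inv s)}.
Proof.
rewrite ltr_norml => /andP[s1 s2] t; rewrite inE /= ler_norml => /andP[t1 t2].
rewrite /slide_inv /slide; have [t0|t0] := ger0P t.
  have -> : t + s * (1 - t) - s = t * (1 - s) by ring.
  have h : 0 <= t * (1 - s) by apply: mulr_ge0; lra.
  by rewrite max_r // min_l // mul0r addr0 mulfK //; apply/eqP; lra.
have -> : t + s * (1 - - t) - s = t * (1 + s) by ring.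
have h : t * (1 + s) <= 0 by apply: mulr_le0_ge0; lra.
by rewrite max_l // min_r // mul0r add0r mulfK //; apply/eqP; lra.
Qed.

Lemma slide_invK s : `|s| < 1 -> {in [pred t | `|t| <= 1], cancel (slide_inv s) (slide s)}.
Proof.
rewrite ltr_norml => /andP[s1 s2] t; rewrite inE /= ler_norml => /andP[t1 t2].
rewrite /slide_inv /slide; have [t0|t0] := lerP 0 (t - s).
  rewrite mul0r addr0 ger0_norm; last by apply: divr_ge0; lra.
  by field; lra.
rewrite mul0r add0r ler0_norm; last by apply: mulr_le0_ge0; [lra|rewrite invr_ge0; lra].
by field; lra.
Qed.

Lemma slide0 s : slide s 0 = s.
Proof. by rewrite /slide normr0; ring. Qed.

Lemma slide_close s t : `|s| <= 2^-1 -> `|slide s t - s| <= 3 / 2 * `|t|.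
Proof.
move=> s1; have -> : slide s t - s = t - s * `|t| by rewrite /slide; ring.
rewrite (le_trans (ler_normB _ _)) // normrM normr_id.
have := normr_ge0 t; nra.
Qed.

Lemma dilate_den d t : 0 < d -> `|t| <= 1 -> 0 < `|t| + d * (1 - `|t|).
Proof.
move=> d0 t1; have [->|t0] := eqVneq `|t| 1; first by nra.
have := normr_ge0 t; have : `|t| < 1 by rewrite lt_neqAle t0.
by nra.
Qed.

Lemma norm_dilate d t : 0 < d -> `|t| <= 1 ->
  `|dilate d t| = `|t| / (`|t| + d * (1 - `|t|)).
Proof. by move=> d0 t1; rewrite normrM normfV (gtr0_norm (dilate_den d0 t1)). Qed.

Lemma dilate_norm d t : 0 < d -> `|t| <= 1 -> `|dilate d t| <= 1.
Proof.
move=> d0 t1; rewrite norm_dilate // ler_pdivrMr ?dilate_den // mul1r.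
by rewrite lerDl mulr_ge0 //; lra.
Qed.

(** Away from the end points, [dilate d] divides the ratio |t| / (1 - |t|) by [d]. *)
Lemma dilateK d : 0 < d -> {in [pred t | `|t| <= 1], cancel (dilate d) (dilate d^-1)}.
Proof.
move=> d0 t; rewrite inE /= => t1; rewrite {1}/dilate norm_dilate // /dilate.
have D := dilate_den d0 t1; set n := `|t| in t1 D *.
have n0 : 0 <= n := normr_ge0 t.
have -> : n / (n + d * (1 - n)) + d^-1 * (1 - n / (n + d * (1 - n))) = (n + d * (1 - n))^-1.
  by field; rewrite !gt_eqF.
by field; rewrite !gt_eqF.
Qed.

Lemma slide_continuous (S : topologicalType) (s t : S -> R) :
  continuous s -> continuous t -> continuous (fun x => slide (s x) (t x)).
Proof.
move=> cs ct x; apply: cvgD; first exact: ct.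
apply: cvgM; first exact: cs.
by apply: cvgB; [exact: cvg_cst|apply: cvg_norm; exact: ct].
Qed.

Lemma slide_inv_continuous (S : topologicalType) (s t : S -> R) :
  (forall x, `|s x| < 1) ->
  continuous s -> continuous t -> continuous (fun x => slide_inv (s x) (t x)).
Proof.
move=> s1 cs ct x; have := s1 x; rewrite ltr_norml => /andP[s2 s3].
have cd : (fun x => t x - s x) @ x --> t x - s x by apply: cvgB; [exact: ct|exact: cs].
apply: cvgD; apply: cvgM.
- by apply: (@continuous_max _ _ (fun=> 0) (fun x => t x - s x)); [exact: cst_continuous|exact: cd].
- by apply: cvgV; [apply/eqP; lra|apply: cvgB; [exact: cvg_cst|exact: cs]].
- by apply: (@continuous_min _ _ (fun=> 0) (fun x => t x - s x)); [exact: cst_continuous|exact: cd].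
- by apply: cvgV; [apply/eqP; lra|apply: cvgD; [exact: cvg_cst|exact: cs]].
Qed.

Lemma dilate_continuous (S : topologicalType) d (t : S -> R) : 0 < d ->
  (forall x, `|t x| <= 1) -> continuous t -> continuous (fun x => dilate d (t x)).
Proof.
move=> d0 t1 ct x; apply: cvgM; first exact: ct.
have cn : (fun x => `|t x|) @ x --> `|t x| by apply: cvg_norm; exact: ct.
apply: cvgV; first by rewrite gt_eqF // dilate_den.
apply: cvgD => //; apply: cvgM; first exact: cvg_cst.
by apply: cvgB => //; exact: cvg_cst.
Qed.

Lemma continuous_subr (S : topologicalType) (f g : S -> R) :
  continuous f -> continuous g -> continuous (fun x => f x - g x).
Proof. by move=> cf cg x; apply: cvgB; [exact: cf|exact: cg]. Qed.

Lemma continuous_addr (S : topologicalType) (f g : S -> R) :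
  continuous f -> continuous g -> continuous (fun x => f x + g x).
Proof. by move=> cf cg x; apply: cvgD; [exact: cf|exact: cg]. Qed.

Lemma continuous_scaler (S : topologicalType) (a : R) (f : S -> R) :
  continuous f -> continuous (fun x => a * f x).
Proof. by move=> cf x; apply: cvgM; [exact: cvg_cst|exact: cf]. Qed.

Lemma continuous_maxr (S : topologicalType) (f g : S -> R) :
  continuous f -> continuous g -> continuous (fun x => Num.max (f x) (g x)).
Proof. by move=> cf cg x; apply: (@continuous_max _ _ f g); [exact: cf|exact: cg]. Qed.

Lemma continuous_minr (S : topologicalType) (f g : S -> R) :
  continuous f -> continuous g -> continuous (fun x => Num.min (f x) (g x)).
Proof. by move=> cf cg x; apply: (@continuous_min _ _ f g); [exact: cf|exact: cg]. Qed.

Lemma continuous_normr (S : topologicalType) (f : S -> R) :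
  continuous f -> continuous (fun x => `|f x|).
Proof. by move=> cf x; apply: cvg_norm; exact: cf. Qed.

Lemma continuous_affine (S : topologicalType) (a b : R) (f : S -> R) :
  continuous f -> continuous (fun x => a * f x + b).
Proof.
move=> cf x; apply: cvgD; last exact: cvg_cst.
by apply: cvgM; [exact: cvg_cst|exact: cf].
Qed.

End slide.

(** * Series with weights 4^-(n+1) *)

Section geometric.
Variable R : realType.
Implicit Types c : nat -> R.

Lemma norm_quarter_lt1 : `|4^-1 : R| < 1.
Proof. by rewrite ger0_norm ?invr_ge0 //; lra. Qed.

(** With ratio 1/4, terms bounded by 1 sum to at most 1/3, an admissible amount for [slide]; and 0-1
    sequences that first differ at n are told apart, since 4^-(n+1) exceeds the two tails, together
    at most 2/3 of it. *)
Definition wsum c : R := limn (series (fun n => 4^-1 ^+ n.+1 * c n)).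

Lemma wsum_step c N M : (forall n, `|c n| <= 1) -> (N <= M)%N ->
  `|series (fun n => 4^-1 ^+ n.+1 * c n) M - series (fun n => 4^-1 ^+ n.+1 * c n) N|
    <= 3^-1 * (4^-1 ^+ N - 4^-1 ^+ M).
Proof.
move=> c1; elim: M => [|M IH]; first by rewrite leqn0 => /eqP ->; rewrite !subrr normr0 mulr0.
rewrite leq_eqVlt => /orP[/eqP ->|NM]; first by rewrite !subrr normr0 mulr0.
have {IH NM} := IH NM; rewrite /series /= big_nat_recr //=.
set a := (\sum_(0 <= i < M) _); set b := (\sum_(0 <= i < N) _) => H.
have -> : a + 4^-1 ^+ M.+1 * c M - b = (a - b) + 4^-1 ^+ M.+1 * c M by ring.
rewrite (le_trans (ler_normD _ _)) // normrM ger0_norm; last by rewrite exprn_ge0.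
have p : 0 <= 4^-1 ^+ M.+1 :> R by rewrite exprn_ge0.
have := c1 M; move: H; rewrite (exprS _ M); move: p; rewrite exprS.
set q := 4^-1 ^+ M; nra.
Qed.

Lemma wsum_cvg c : (forall n, `|c n| <= 1) ->
  series (fun n => 4^-1 ^+ n.+1 * c n) @ \oo --> wsum c.
Proof.
move=> c1; apply: normed_cvg.
apply: (@series_le_cvg _ _ (geometric (4^-1) (4^-1))).
- by move=> n /=; exact: normr_ge0.
- by move=> n; rewrite /= mulr_ge0 ?exprn_ge0.
- move=> n /=; rewrite normrM ger0_norm ?exprn_ge0 // exprS.
  have p : 0 <= 4^-1 * 4^-1 ^+ n :> R by rewrite mulr_ge0 ?exprn_ge0.
  by have := c1 n; nra.
- by apply: is_cvg_geometric_series; exact: norm_quarter_lt1.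
Qed.

Lemma wsum_tail c N : (forall n, `|c n| <= 1) ->
  `|wsum c - series (fun n => 4^-1 ^+ n.+1 * c n) N| <= 3^-1 * 4^-1 ^+ N.
Proof.
move=> c1; set s := series _.
have cv : (fun M => `|s M - s N|) @ \oo --> `|wsum c - s N|.
  by apply: cvg_norm; apply: cvgB; [exact: wsum_cvg|exact: cvg_cst].
rewrite -(cvg_lim _ cv) //; apply: limr_le; first by apply/cvg_ex; exists `|wsum c - s N|.
near=> M; apply: le_trans (wsum_step (N := N) (M := M) c1 _) _.
  by near: M; exact: nbhs_infty_ge.
by rewrite ler_pM2l ?invr_gt0 // gerBl exprn_ge0.
Unshelve. all: end_near. Qed.

Lemma wsum_norm c : (forall n, `|c n| <= 1) -> `|wsum c| <= 3^-1.
Proof. by move=> c1; have := wsum_tail 0 c1; rewrite /series /= big_geq // subr0 mulr1. Qed.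

Lemma wsum_continuous (S : topologicalType) (c : S -> nat -> R) :
  (forall x n, `|c x n| <= 1) -> (forall n, continuous (fun x => c x n)) ->
  continuous (fun x => wsum (c x)).
Proof.
move=> c1 cc x; apply/cvgrPdist_lt => e e0.
have cs N : (fun x => series (fun n => 4^-1 ^+ n.+1 * c x n) N) @ x --> series (fun n => 4^-1 ^+ n.+1 * c x n) N.
  rewrite /series /=; elim: N => [|N IH].
    by rewrite big_geq //; under eq_fun do rewrite big_geq //; exact: cvg_cst.
  rewrite big_nat_recr //=; under eq_fun do rewrite big_nat_recr //=.
  by apply: cvgD => //; apply: cvgM; [exact: cvg_cst|exact: cc].
have [N Ne] : exists N, 4^-1 ^+ N < e.
  have : (fun N => 4^-1 ^+ N : R) @ \oo --> 0 by apply: cvg_expr; exact: norm_quarter_lt1.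
  move=> /cvgrPdist_lt/(_ e e0)[N _ /(_ N (leqnn N))]; rewrite /= sub0r normrN ger0_norm ?exprn_ge0 // => h.
  by exists N.
have e3 : 0 < 3^-1 * e by rewrite mulr_gt0 ?invr_gt0.
have /cvgrPdist_lt/(_ _ e3) := cs N; apply: filterS => y.
have := wsum_tail N (c1 x); have := wsum_tail N (c1 y).
set a := series _ _; set b := series _ _; set u := wsum _; set v := wsum _.
rewrite !ler_norml !ltr_norml => /andP[? ?] /andP[? ?] /andP[? ?]; apply/andP; split; lra.
Qed.

End geometric.

(** * Homeomorphisms of the cube *)

Section cube_homeomorphisms.
Variable R : realType.
Local Notation Q := (hilbert_cube R).

Definition jcoord (x : Q) (n : nat) : R := 2 * coord x n - 1.

Definition jmk (f : nat -> R) : Q := mk (fun n => (f n + 1) / 2).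

Lemma jcoord_norm x n : `|jcoord x n| <= 1.
Proof. by rewrite /jcoord ler_norml; have := coord_itv x n; lra. Qed.

Lemma jcoord_mk f n : `|f n| <= 1 -> jcoord (jmk f) n = f n.
Proof.
rewrite ler_norml => fn; rewrite /jcoord /jmk coord_mk; last by lra.
by field.
Qed.

Lemma jcoord_inj (x y : Q) : (forall n, jcoord x n = jcoord y n) -> x = y.
Proof. by move=> xy; apply: coord_inj => n; have := xy n; rewrite /jcoord; lra. Qed.

Lemma jcoord_continuous n : continuous (fun x => jcoord x n).
Proof.
by apply: continuous_affine; exact: coord_continuous.
Qed.

Lemma jmk_continuous (S : topologicalType) (f : S -> nat -> R) :
  (forall n, continuous (fun s => f s n)) -> continuous (fun s => jmk (f s)).
Proof.
move=> cf; apply: mk_continuous => n s.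
by apply: cvgM; [apply: cvgD; [exact: cf|exact: cvg_cst]|exact: cvg_cst].
Qed.

(** Compactness of the cube provides the continuity of the inverse, which leaves bounds, two
    identities and the continuity of [F] to check. *)
Lemma cube_homeomorphism (F G : Q -> nat -> R) :
  (forall x n, `|F x n| <= 1) -> (forall x n, `|G x n| <= 1) ->
  (forall n, continuous (fun x => F x n)) ->
  (forall x n, F (jmk (G x)) n = jcoord x n) ->
  (forall x n, G (jmk (F x)) n = jcoord x n) ->
  homeomorphism (fun x => jmk (F x)).
Proof.
move=> F1 G1 cF FG GF.
apply: (@compact_homeomorphism _ _ _ (fun x => jmk (G x))).
- exact: cube_compact.
- exact: cube_hausdorff.
- exact: jmk_continuous.
- by move=> x; apply: jcoord_inj => n; rewrite jcoord_mk // GF.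
- by move=> x; apply: jcoord_inj => n; rewrite jcoord_mk // FG.
Qed.

Lemma dilate_homeomorphism (d : nat -> R) : (forall n, 0 < d n) ->
  homeomorphism (fun x => jmk (fun n => dilate (d n) (jcoord x n))).
Proof.
move=> d0; have di0 n : 0 < (d n)^-1 by rewrite invr_gt0.
apply: (@cube_homeomorphism _ (fun x n => dilate (d n)^-1 (jcoord x n))).
- by move=> x n; rewrite dilate_norm // jcoord_norm.
- by move=> x n; rewrite dilate_norm // jcoord_norm.
- move=> n; apply: dilate_continuous => //; last exact: jcoord_continuous.
  by move=> x; exact: jcoord_norm.
- move=> x n; rewrite jcoord_mk ?dilate_norm ?jcoord_norm //.
  by rewrite -{1}(invrK (d n)) dilateK // inE jcoord_norm.
- move=> x n; rewrite jcoord_mk ?dilate_norm ?jcoord_norm //.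
  by rewrite dilateK // inE jcoord_norm.
Qed.

Lemma slide_homeomorphism (s : nat -> R) : (forall n, `|s n| < 1) ->
  homeomorphism (fun x => jmk (fun n => slide_inv (s n) (jcoord x n))).
Proof.
move=> s1; apply: (@cube_homeomorphism _ (fun x n => slide (s n) (jcoord x n))).
- by move=> x n; rewrite slide_inv_norm // jcoord_norm.
- by move=> x n; rewrite slide_norm // jcoord_norm.
- move=> n; apply: slide_inv_continuous => //; last exact: jcoord_continuous.
  exact: cst_continuous.
- move=> x n; rewrite jcoord_mk ?slide_norm ?jcoord_norm //.
  by rewrite slideK // inE jcoord_norm.
- move=> x n; rewrite jcoord_mk ?slide_inv_norm ?jcoord_norm //.
  by rewrite slide_invK // inE jcoord_norm.
Qed.

Definition tail (x : Q) : Q := fun n => x n.+1.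

Lemma jcoord_tail x n : jcoord (tail x) n = jcoord x n.+1.
Proof. by []. Qed.

Lemma tail_continuous : continuous tail.
Proof. by apply: cube_continuous => n; exact: coord_continuous. Qed.

(** The amount depends on the tail alone, which the map fixes, so the inverse can read off the same
    amount. In [tail_slide_homeomorphism] coordinate 0 and the tail exchange roles. *)
Lemma head_slide_homeomorphism (s : Q -> R) : (forall x, `|s x| < 1) ->
  continuous s ->
  homeomorphism (fun x => jmk (fun n =>
    if n is 0 then slide (s (tail x)) (jcoord x 0) else jcoord x n)).
Proof.
move=> s1 cs; pose F x n := if n is 0 then slide (s (tail x)) (jcoord x 0) else jcoord x n.
pose G x n := if n is 0 then slide_inv (s (tail x)) (jcoord x 0) else jcoord x n.
have F1 x n : `|F x n| <= 1 by case: n => [|n] /=; rewrite ?slide_norm ?jcoord_norm.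
have G1 x n : `|G x n| <= 1 by case: n => [|n] /=; rewrite ?slide_inv_norm ?jcoord_norm.
have tF x : tail (jmk (F x)) = tail x.
  by apply: jcoord_inj => n; rewrite jcoord_tail jcoord_mk.
have tG x : tail (jmk (G x)) = tail x.
  by apply: jcoord_inj => n; rewrite jcoord_tail jcoord_mk.
apply: (@cube_homeomorphism F G) => //.
- case=> [|n]; last exact: jcoord_continuous.
  apply: slide_continuous; last exact: jcoord_continuous.
  by move=> x; apply: (@continuous_comp _ _ _ tail s); [exact: tail_continuous|exact: cs].
- move=> x [|n]; last by rewrite /F jcoord_mk.
  by rewrite /F tG jcoord_mk // /G slide_invK // inE jcoord_norm.
- move=> x [|n]; last by rewrite /G jcoord_mk.
  by rewrite /G tF jcoord_mk // /F slideK // inE jcoord_norm.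
Qed.

Lemma tail_slide_homeomorphism (a : nat -> R -> R) :
  (forall n t, `|a n t| < 1) -> (forall n, continuous (a n)) ->
  homeomorphism (fun x => jmk (fun n =>
    if n is m.+1 then slide (a m (jcoord x 0)) (jcoord x n) else jcoord x 0)).
Proof.
move=> a1 ca.
pose F x n := if n is m.+1 then slide (a m (jcoord x 0)) (jcoord x n) else jcoord x 0.
pose G x n := if n is m.+1 then slide_inv (a m (jcoord x 0)) (jcoord x n) else jcoord x 0.
have F1 x n : `|F x n| <= 1 by case: n => [|n] /=; rewrite ?slide_norm ?jcoord_norm.
have G1 x n : `|G x n| <= 1 by case: n => [|n] /=; rewrite ?slide_inv_norm ?jcoord_norm.
apply: (@cube_homeomorphism F G) => //.
- case=> [|n]; first exact: jcoord_continuous.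
  apply: slide_continuous; last exact: jcoord_continuous.
  by move=> x; apply: (@continuous_comp _ _ _ (jcoord^~ 0%N) (a n)); [exact: jcoord_continuous|exact: ca].
- move=> x [|n]; rewrite /F !jcoord_mk //.
  by rewrite /G slide_invK // inE jcoord_norm.
- move=> x [|n]; rewrite /G !jcoord_mk //.
  by rewrite /F slideK // inE jcoord_norm.
Qed.

(* Greedy expansion: [jcoord x 0] is approximated by the sums of
   [4^-(n+1) * z n], where [z n], the new coordinate [n+1], is the old one
   slid to the (truncated) rescaled remainder. *)
Definition trunc (t : R) : R := Num.max (- 2^-1) (Num.min 2^-1 t).

Lemma trunc_norm t : `|trunc t| <= 2^-1.
Proof. by rewrite /trunc ler_norml le_max ge_max ge_min; lra. Qed.

Lemma trunc_id t : `|t| <= 2^-1 -> trunc t = t.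
Proof. by rewrite /trunc ler_norml => /andP[h1 h2]; rewrite min_r // max_r. Qed.

Fixpoint greedy_rem (x : Q) n : R :=
  if n is m.+1 then
    4 * (greedy_rem x m - slide (trunc (greedy_rem x m)) (jcoord x m.+1))
  else 4 * jcoord x 0.

Definition greedy (x : Q) n : R :=
  if n is m.+1 then slide (trunc (greedy_rem x m)) (jcoord x m.+1) else jcoord x 0.

(** The remainders of [greedy_rem], recomputed from the new coordinates ([greedy_expansion]).
    Remainder m involves coordinates up to m only, so the slide of coordinate m + 1 can be recovered
    and undone. *)
Fixpoint expansion_rem (x : Q) n : R :=
  if n is m.+1 then 4 * (expansion_rem x m - jcoord x m.+1) else 4 * jcoord x 0.

Lemma trunc_lt1 t : `|trunc t| < 1.
Proof. by apply: le_lt_trans (trunc_norm t) _; lra. Qed.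

Lemma trunc_continuous (S : topologicalType) (f : S -> R) :
  continuous f -> continuous (fun s => trunc (f s)).
Proof.
move=> cf x; apply: (@continuous_max _ _ (fun=> - 2^-1) (fun s => Num.min 2^-1 (f s))).
  exact: cst_continuous.
by apply: (@continuous_min _ _ (fun=> 2^-1) f); [exact: cst_continuous|exact: cf].
Qed.

Lemma greedy_rem_continuous n : continuous (fun x => greedy_rem x n).
Proof.
elim: n => [|n IH] /=.
  under eq_fun do rewrite -[4 * _]addr0.
  by apply: continuous_affine; exact: jcoord_continuous.
under eq_fun do rewrite -[4 * _]addr0.
apply: continuous_affine; apply: continuous_subr => //.
by apply: slide_continuous; [exact: trunc_continuous|exact: jcoord_continuous].
Qed.

Lemma greedy_norm x n : `|greedy x n| <= 1.
Proof. by case: n => [|n]; rewrite /greedy ?slide_norm ?trunc_lt1 ?jcoord_norm. Qed.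

Lemma greedy_expansion x n : expansion_rem (jmk (greedy x)) n = greedy_rem x n.
Proof.
elim: n => [|n IH] /=; first by rewrite jcoord_mk ?greedy_norm.
by rewrite IH jcoord_mk ?greedy_norm.
Qed.

Lemma greedy_homeomorphism : homeomorphism (fun x => jmk (greedy x)).
Proof.
pose G x n := if n is m.+1 then slide_inv (trunc (expansion_rem x m)) (jcoord x m.+1) else jcoord x 0.
have G1 x n : `|G x n| <= 1 by case: n => [|n]; rewrite /G ?slide_inv_norm ?trunc_lt1 ?jcoord_norm.
have rG x n : greedy_rem (jmk (G x)) n = expansion_rem x n.
  elim: n => [|n IH]; first by rewrite /= jcoord_mk.
  have E : greedy_rem (jmk (G x)) n.+1 = 4 * (greedy_rem (jmk (G x)) n -
      slide (trunc (greedy_rem (jmk (G x)) n)) (jcoord (jmk (G x)) n.+1)) by [].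
  rewrite E IH jcoord_mk // /G.
  by rewrite slide_invK ?trunc_lt1 // inE jcoord_norm.
apply: (@cube_homeomorphism greedy G) => //.
- exact: greedy_norm.
- case=> [|n]; first exact: jcoord_continuous.
  apply: slide_continuous; last exact: jcoord_continuous.
  by apply: trunc_continuous; exact: greedy_rem_continuous.
- move=> x [|n]; rewrite /greedy jcoord_mk // rG /G.
  by rewrite slide_invK ?trunc_lt1 // inE jcoord_norm.
- move=> x [|n]; rewrite /G jcoord_mk ?greedy_norm // greedy_expansion /greedy.
  by rewrite slideK ?trunc_lt1 // inE jcoord_norm.
Qed.

(** The bound 1/12 keeps the truncation inactive: by [slide_close], a remainder in [-1/2, 1/2] is
    followed by one of size at most 4 * 3/2 * 1/12 = 1/2. *)
Lemma greedy_rem_le (x : Q) n : (forall m, `|jcoord x m| <= 12^-1) ->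
  `|greedy_rem x n| <= 2^-1.
Proof.
move=> x1; elim: n => [|n IH] /=.
  by rewrite normrM ger0_norm //; have := x1 0%N; lra.
rewrite trunc_id // normrM ger0_norm // distrC.
have := slide_close (jcoord x n.+1) IH; have := x1 n.+1; lra.
Qed.

Lemma greedy_sum (x : Q) : (forall m, `|jcoord x m| <= 12^-1) ->
  jcoord x 0 = wsum (fun n => greedy x n.+1).
Proof.
move=> x1; set c := fun n => greedy x n.+1.
have c1 n : `|c n| <= 1 by exact: greedy_norm.
have E N : jcoord x 0 - series (fun n => 4^-1 ^+ n.+1 * c n) N = 4^-1 ^+ N.+1 * greedy_rem x N.
  elim: N => [|N IH]; first by rewrite /series /= big_geq // subr0 expr1; field.
  rewrite /series /= big_nat_recr //= opprD addrA IH [in RHS]exprS /c /greedy.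
  by field.
apply/eqP; rewrite -subr_eq0 -normr_le0; apply/ler_addgt0Pr => e e0; rewrite add0r.
have [N Ne] : exists N, 4^-1 ^+ N < e.
  have : (fun N => 4^-1 ^+ N : R) @ \oo --> 0 by apply: cvg_expr; exact: norm_quarter_lt1.
  move=> /cvgrPdist_lt/(_ e e0)[N _ /(_ N (leqnn N))]; rewrite /= sub0r normrN ger0_norm ?exprn_ge0 // => h.
  by exists N.
have := wsum_tail N c1; have := E N; have := greedy_rem_le N x1.
have : 0 <= 4^-1 ^+ N :> R by rewrite exprn_ge0.
rewrite exprS; set s := series _ _; set w := wsum _; set q := 4^-1 ^+ N; set r := greedy_rem _ _.
rewrite !ler_norml => q0 r1 s1 ws.
have : - q <= q * r <= q by nra.
have : - (3^-1 * q) <= w - s <= 3^-1 * q by [].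
by rewrite -/q in Ne; lra.
Qed.

Lemma straighten_homeomorphism (A : set Q) (d : nat -> R) :
  (forall n, d n < 1) -> (forall x n, A x -> `|jcoord x n| <= d n) ->
  exists h : Q -> Q, homeomorphism h /\ forall x, A x ->
    jcoord (h x) 0 = 0 /\ forall n, `|jcoord (h x) n| <= 3 / 4.
Proof.
(* On [A] the product of [e n] and 1 - |t| is at least 12, so this dilation brings every coordinate
   below 1/12. *)
move=> d1 Ad; pose e n := 12 / (1 - d n).
have e0 n : 0 < e n by rewrite divr_gt0 // subr_gt0.
have s1 (x : Q) : `|wsum (jcoord x)| < 1.
  by apply: le_lt_trans (wsum_norm _) _; [exact: jcoord_norm|lra].
have cs : continuous (fun x : Q => wsum (jcoord x)).
  by apply: wsum_continuous; [exact: jcoord_norm|exact: jcoord_continuous].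
have [g [hg sg gs]] := homeomorphism_inv (head_slide_homeomorphism s1 cs).
set u := fun x => jmk (fun n => dilate (e n) (jcoord x n)).
have u1 x n : A x -> `|jcoord (u x) n| <= 12^-1.
  move=> Ax; have x1 := jcoord_norm x n.
  rewrite jcoord_mk ?dilate_norm // norm_dilate // ler_pdivrMr ?dilate_den //.
  have : 12 <= e n * (1 - `|jcoord x n|).
    rewrite /e mulrAC ler_pdivlMr ?subr_gt0 // ler_pM2l //.
    by have := Ad x n Ax; lra.
  by lra.
exists (g \o (fun x => jmk (greedy x)) \o u); split.
  apply: homeomorphism_comp; first exact: dilate_homeomorphism.
  by apply: homeomorphism_comp => //; exact: greedy_homeomorphism.
move=> x Ax /=; set y := jmk (greedy (u x)).
have uA n := u1 x n Ax.
have y0 : jcoord y 0 = wsum (jcoord (tail y)).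
  rewrite jcoord_mk ?greedy_norm // [LHS](greedy_sum uA).
  by congr wsum; apply/funext => n; rewrite jcoord_tail jcoord_mk ?greedy_norm.
(* After the greedy step coordinate 0 is the weighted sum of the tail, which is the value that the
   head slide gives to 0. Its inverse [g] therefore resets coordinate 0 to 0. *)
pose zf n : R := if n is 0 then 0 else jcoord y n.
have z1 n : `|zf n| <= 1 by case: n => [|n]; rewrite /zf ?normr0 ?jcoord_norm.
pose z : Q := jmk zf.
have tz : tail z = tail y.
  by apply: jcoord_inj => n; rewrite jcoord_tail (@jcoord_mk zf _ (z1 n.+1)).
have -> : g y = z.
  rewrite -[z]sg; congr g; apply: jcoord_inj => n; rewrite jcoord_mk; last first.
    by case: n => [|n]; [apply: slide_norm; [exact: s1|exact: jcoord_norm]|exact: jcoord_norm].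
  by case: n => [|n]; rewrite (@jcoord_mk zf _ (z1 _)) ?tz ?slide0.
split; first by rewrite (@jcoord_mk zf _ (z1 0%N)).
case=> [|n]; rewrite (@jcoord_mk zf _ (z1 _)); first by rewrite /zf normr0; lra.
rewrite /zf jcoord_mk ?greedy_norm // /greedy.
(* A remainder of at most 1/2 and a deviation of at most 3/2 * 1/12 = 1/8 stay below 3/4; Klee's
   trick needs a uniform bound below 1. *)
have r1 := greedy_rem_le n uA.
rewrite trunc_id //; have h := slide_close (jcoord (u x) n.+1) r1; have u1' := uA n.+1.
have {h u1'} : `|slide (greedy_rem (u x) n) (jcoord (u x) n.+1) - greedy_rem (u x) n| <= 8^-1 by lra.
by move: r1; rewrite !ler_norml; set S := slide _ _; lra.
Qed.

End cube_homeomorphisms.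

(** * Klee's trick *)

Section cantor_extension.
Variable R : realType.

(** Tietze's theorem for [u] transported to the range of [f], which is compact, hence closed. [k]
    chooses preimages, with a default value off the range. *)
Lemma cantor_tietze (X : topologicalType) (f : cantor_space -> X)
    (u : cantor_space -> R) (M : R) :
  compact [set: X] -> hausdorff_space X -> continuous f -> injective f ->
  0 < M -> continuous u -> (forall c, `|u c| <= M) ->
  exists v : X -> R,
    [/\ continuous v, forall x, `|v x| <= M & forall c, v (f c) = u c].
Proof.
move=> cX hX cf fI M0 cu uM.
have [g [cg gI fg]] := range_inverse_continuous hX cf fI.
have /choice[k kP] : forall x, exists c : cantor_space, range f x -> f c = x.
  move=> x; have [[c _ <-]|nx] := pselect (range f x); first by exists c.
  by exists point.
have gk (a : set_type (range f)) : k (set_val a) = g a.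
  by apply: fI; rewrite fg kP //; exact: set_valP.
have clA : closed (range f).
  apply: compact_closed => //; apply: continuous_compact; first exact: continuous_subspaceT.
  exact: cantor_space_compact.
have wA : {within range f, continuous (u \o k : X -> R^o)}.
  apply/subspace_sigL_continuousP.
  have -> : sigL (range f) (u \o k : X -> R^o) = (u \o g).
    by apply/funext => a; rewrite /sigL /= gk.
  by move=> a; apply: continuous_comp; [exact: cg|exact: cu].
have [v [uv cv vM]] := continuous_bounded_extension (compact_normal hX cX) clA M0 wA (fun x _ => uM (k x)).
exists v; split => // c; rewrite -uv /=; last by rewrite inE; exact: imageT.
by congr u; apply: fI; rewrite kP //; exact: imageT.
Qed.

Definition cantor_real (c : cantor_space) : R := wsum (fun n => (c n)%:R).

Lemma nat_of_bool_norm (b : bool) : `|b%:R : R| <= 1.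
Proof. by case: b; rewrite ?normr1 ?normr0. Qed.

Lemma cantor_real_norm c : `|cantor_real c| <= 3^-1.
Proof. by apply: wsum_norm => n; exact: nat_of_bool_norm. Qed.

Lemma cantor_real_continuous : continuous cantor_real.
Proof.
apply: wsum_continuous => [c n|n]; first exact: nat_of_bool_norm.
move=> c; apply: (@continuous_comp _ _ _ (fun c : cantor_space => c n) (fun b : bool => b%:R : R)).
  exact: (@prod_proj_continuous nat (fun=> bool) n c).
by move=> U /nbhs_singleton /= Ub; rewrite nbhsE /=; exists [set c n] => [|b ->]; [split => //; exact: discrete_open|].
Qed.

Lemma cantor_real_inj : injective cantor_real.
Proof.
move=> c d cd; apply/funext; apply: contrapT => /existsNP[n0 n0P].
have ex : exists n, c n != d n by exists n0; apply/eqP.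
case: (ex_minnP ex) => n cdn nmin.
have c1 (x : cantor_space) k : `|(x k)%:R : R| <= 1 by exact: nat_of_bool_norm.
have := wsum_tail n.+1 (c1 c); have := wsum_tail n.+1 (c1 d).
rewrite -!/(cantor_real _) cd; set w := cantor_real d.
rewrite /series /= !big_nat_recr //=.
have -> : \sum_(0 <= i < n) 4^-1 ^+ i.+1 * (c i)%:R = \sum_(0 <= i < n) 4^-1 ^+ i.+1 * (d i)%:R :> R.
  apply: eq_big_nat => i /andP[_ ilt]; congr (_ * (nat_of_bool _)%:R).
  by apply/eqP/negPn/negP => cdi; have := nmin _ cdi; rewrite leqNgt ilt.
set s := \sum_(0 <= i < n) _; have : 0 < 4^-1 ^+ n.+1 :> R by rewrite exprn_gt0.
by move: cdn; case: (c n); case: (d n) => //= _; rewrite !ler_norml; set q := 4^-1 ^+ _; lra.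
Qed.

Local Notation Q := (hilbert_cube R).

Definition cantor_line (c : cantor_space) : Q :=
  jmk (fun n => if n is 0 then cantor_real c else 0).

(* Klee's trick: [(0, f c)] is slid to [(cantor_real c, f c)] along the first
   coordinate, then to [(cantor_real c, 0)] along the others, the amounts being
   continuous extensions to the whole cube. *)
Lemma klee_homeomorphism (f : cantor_space -> Q) :
  continuous f -> injective f -> (forall c, jcoord (f c) 0 = 0) ->
  (forall c n, `|jcoord (f c) n| <= 3 / 4) ->
  exists2 h : Q -> Q, homeomorphism h & forall c, h (f c) = cantor_line c.
Proof.
move=> cf fI f0 f1; pose e c := cantor_real c.
have e1 c : `|e c| <= 1 by apply: le_trans (cantor_real_norm c) _; lra.
have ctf : continuous (@tail R \o f).
  by move=> c; apply: continuous_comp; [exact: cf|exact: tail_continuous].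
have tfI : injective (@tail R \o f).
  move=> c d cd; apply: fI; apply: jcoord_inj => -[|n]; first by rewrite !f0.
  by rewrite -!jcoord_tail; exact: (congr1 (fun x => jcoord x n) cd).
have [s [cs s1 se]] := cantor_tietze (@cube_compact R) (@cube_hausdorff R) ctf tfI
  (M := 3^-1) ltac:(by rewrite invr_gt0) cantor_real_continuous cantor_real_norm.
have s1' x : `|s x| < 1 by apply: le_lt_trans (s1 x) _; lra.
(* The slides of the tail must be controlled by the real number in coordinate 0. It is placed on the
   diagonal of the cube, a compact space to which [cantor_tietze] applies. *)
pose e' c : Q := jmk (fun=> e c).
have ce' : continuous e' by apply: jmk_continuous => _; exact: cantor_real_continuous.
have e'I : injective e'.
  move=> c d /(congr1 (fun x => jcoord x 0)); rewrite !jcoord_mk //.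
  exact: cantor_real_inj.
have /choice[a aP] : forall n, exists v : Q -> R, [/\ continuous v,
    forall x, `|v x| <= 3 / 4 & forall c, v (e' c) = jcoord (f c) n.+1].
  move=> n; apply: cantor_tietze => //; try lra.
  - exact: cube_compact.
  - exact: cube_hausdorff.
  - exact: (fun c => @continuous_comp _ _ _ f (fun x => jcoord x n.+1) c (cf c) (@jcoord_continuous R n.+1 (f c))).
pose A n (t : R) := a n (jmk (fun=> t)).
have A1 n t : `|A n t| < 1 by have [_ + _] := aP n => /(_ (jmk (fun=> t))) h; apply: le_lt_trans h _; lra.
have cA n : continuous (A n).
  have [ca _ _] := aP n; move=> t; apply: (@continuous_comp _ _ _ (fun t => jmk (fun=> t)) (a n)); last exact: ca.
  by apply: jmk_continuous => _ ?; exact: cvg_id.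
have [g [hg sg gs]] := homeomorphism_inv (tail_slide_homeomorphism A1 cA).
exists (g \o (fun x => jmk (fun n => if n is 0 then slide (s (tail x)) (jcoord x 0) else jcoord x n))).
  by apply: homeomorphism_comp => //; exact: head_slide_homeomorphism.
move=> c /=; rewrite -[RHS]sg; congr g; apply: jcoord_inj => n.
have z n' : jcoord (cantor_line c) n' = if n' is 0 then e c else 0.
  by rewrite jcoord_mk //; case: n' => [|n']; [exact: e1|rewrite normr0].
have b1 m : `|(if m is 0 then slide (s (tail (f c))) (jcoord (f c) 0) else jcoord (f c) m)| <= 1.
  by case: m => [|m]; rewrite ?slide_norm ?jcoord_norm.
have b2 m : `|(if m is k.+1
    then slide (A k (jcoord (cantor_line c) 0)) (jcoord (cantor_line c) m)
    else jcoord (cantor_line c) 0)| <= 1.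
  by case: m => [|m]; rewrite ?slide_norm ?jcoord_norm.
rewrite jcoord_mk // jcoord_mk //.
case: n => [|n]; first by rewrite f0 slide0 z; exact: se.
by rewrite !z slide0 /A; have [_ _ ->] := aP n.
Qed.

End cantor_extension.

(** * Pushing into the pseudo-interior *)

(** Otherwise counterexamples agreeing with [x] on longer and longer prefixes would converge to [x]
    outside [U]. *)
Lemma prod_nbhs_prefix (T : nat -> topologicalType) (x : prod_topology T) U :
  nbhs x U -> exists N, forall v : prod_topology T,
    (forall n, (n < N)%N -> v n = x n) -> U v.
Proof.
move=> xU; apply: contrapT => /forallNP H.
have /choice[v vP] : forall N, exists v : prod_topology T,
    (forall n, (n < N)%N -> v n = x n) /\ ~ U v.
  by move=> N; have /existsNP[v /not_implyP] := H N; exists v.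
have : v @ \oo --> x.
  apply/cvg_sup => i A [B [[W oW <-] Wx WA]].
  exists i.+1 => // N /= iN; apply: WA; rewrite /= (vP N).1 //.
by move=> /(_ U xU)[N _ /(_ N (leqnn N))]; exact: (vP N).2.
Qed.

Section push.
Variable R : realType.
Implicit Types e x y p q w z : R.

(* In the coordinates [m = max |x| |y|] and [d = |x| - |y|] of a quadrant of the
   square [[-1, 1]^2], [push] keeps [m] and replaces [d] by
   [d - e * (m - |d|)].  It thus moves the parts [|y| > (1 + e)^-1] of the sides
   [|x| = 1] into the sides [|y| = 1]. *)
Definition push1 e x y : R :=
  Num.max ((1 - e) * x) (Num.min x (2 * x - (1 + e) * `|y|))
  + Num.min ((1 - e) * x) (Num.max x (2 * x + (1 + e) * `|y|)) - (1 - e) * x.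

Definition push2 e x y : R :=
  Num.max y (Num.min `|x| ((1 + e) * y))
  + Num.min y (Num.max (- `|x|) ((1 + e) * y)) - y.

(** The map on a quadrant, as a relation between absolute values: three linear pieces that agree on
    their common boundaries. Comparing two points becomes nine cases of arithmetic. *)
Definition push_spec e p q p' q' :=
  [\/ [/\ (1 + e) * q <= p, p' = p & q' = (1 + e) * q],
      [/\ q <= p, p <= (1 + e) * q, p' = 2 * p - (1 + e) * q & q' = p] |
      [/\ p <= q, p' = (1 - e) * p & q' = q]].

Lemma push_spec_eq0 e p q a b : 0 < e < 1 -> 0 <= p -> 0 <= q ->
  push_spec e p q a b -> ((a == 0) = (p == 0)) * ((b == 0) = (q == 0)).
Proof.
move=> /andP[e0 e1] p0 q0 [[h1 -> ->]|[h1 h2 -> ->]|[h1 -> ->]]; split => //;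
  by apply/eqP/eqP => h; nra.
Qed.

Lemma push1N e x y : push1 e (- x) y = - push1 e x y.
Proof.
rewrite /push1 !mulrN; set k := (1 + e) * _; set a := (1 - e) * x.
have -> : - (2 * x) - k = - (2 * x + k) by ring.
have -> : - (2 * x) + k = - (2 * x - k) by ring.
by rewrite -oppr_max -oppr_min -oppr_min -oppr_max; ring.
Qed.

Lemma push2N e x y : push2 e x (- y) = - push2 e x y.
Proof.
rewrite /push2 !mulrN; set a := (1 + e) * y; set p := `|x|.
rewrite -{1}[p]opprK -oppr_max -oppr_min -oppr_min -oppr_max opprK; ring.
Qed.

(** The definition of [push1] is symmetrised to be odd in [x] without a case distinction; for
    nonnegative [x] the minimum equals [(1 - e) * x] and cancels. *)
Lemma push1_ge0 e x y : 0 < e < 1 -> 0 <= x ->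
  push1 e x y = Num.max ((1 - e) * x) (Num.min x (2 * x - (1 + e) * `|y|)).
Proof.
move=> /andP[e0 e1] x0; rewrite /push1 [Num.min _ (Num.max _ _)]min_l ?addrK //.
by rewrite le_max; apply/orP; left; nra.
Qed.

Lemma push2_ge0 e x y : 0 < e < 1 -> 0 <= y ->
  push2 e x y = Num.max y (Num.min `|x| ((1 + e) * y)).
Proof.
move=> /andP[e0 e1] y0; rewrite /push2 [Num.min _ (Num.max _ _)]min_l ?addrK //.
by rewrite le_max; apply/orP; right; nra.
Qed.

Lemma push_spec_ex e p q : 0 < e < 1 -> 0 <= p -> 0 <= q -> push_spec e p q
  (Num.max ((1 - e) * p) (Num.min p (2 * p - (1 + e) * q)))
  (Num.max q (Num.min p ((1 + e) * q))).
Proof.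
move=> /andP[e0 e1] p0 q0; have /orP[h1|h1] := le_total ((1 + e) * q) p.
  apply: Or31; split => //; first by rewrite min_l ?max_r //; nra.
  by rewrite min_r // max_r //; nra.
have /orP[h2|h2] := le_total q p.
  apply: Or32; split => //; first by rewrite min_r ?max_r //; nra.
  by rewrite min_l // max_r.
apply: Or33; split => //; last by rewrite min_l // max_l.
by rewrite max_l // ge_min; apply/orP; right; nra.
Qed.

Lemma pushP e x y : 0 < e < 1 ->
  exists p' q', [/\ push_spec e `|x| `|y| p' q',
    push1 e x y = Num.sg x * p' & push2 e x y = Num.sg y * q'].
Proof.
move=> e01; have s := push_spec_ex e01 (normr_ge0 x) (normr_ge0 y).
have [h1 h2] := push_spec_eq0 e01 (normr_ge0 x) (normr_ge0 y) s.
do 2 eexists; split; first exact: s.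
  have [x0|x0|x0] := ltrgtP x 0.
  - rewrite ltr0_sg // mulN1r ltr0_norm // -[LHS]opprK -push1N push1_ge0 //.
    by rewrite oppr_ge0 ltW.
  - by rewrite gtr0_sg // mul1r gtr0_norm // push1_ge0 // ltW.
  - move: h1; rewrite x0 sgr0 mul0r normr0 eqxx => /eqP h1.
    by rewrite push1_ge0.
have [y0|y0|y0] := ltrgtP y 0.
- rewrite ltr0_sg // mulN1r (ltr0_norm y0) -[LHS]opprK -push2N push2_ge0 //.
  by rewrite oppr_ge0 ltW.
- by rewrite gtr0_sg // mul1r (gtr0_norm y0) push2_ge0 // ltW.
- move: h2; rewrite y0 sgr0 mul0r normr0 eqxx => /eqP h2.
  by rewrite push2_ge0.
Qed.

Lemma push_spec_uniq e p q a b a' b' : 0 < e < 1 -> 0 <= p -> 0 <= q ->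
  push_spec e p q a b -> push_spec e p q a' b' -> a = a' /\ b = b'.
Proof.
move=> /andP[e0 e1] p0 q0 s s'.
have ep : 0 <= e * p by apply: mulr_ge0 => //; exact: ltW.
have eq : 0 <= e * q by apply: mulr_ge0 => //; exact: ltW.
move: s s'; rewrite /push_spec !mulrBl !mulrDl !mul1r.
have eq0 : e * q <= 0 -> q = 0 by move=> h; nra.
by move=> [[h1 -> ->]|[h1 h2 -> ->]|[h1 -> ->]] [[k1 -> ->]|[k1 k2 -> ->]|[k1 -> ->]];
  split => //; first [lra | (have -> : p = q by lra); lra |
    (have q1 : q = 0 by apply: eq0; lra); (have p1 : p = 0 by lra); rewrite p1 q1 !mulr0; lra].
Qed.

Lemma push_spec_itv e p q a b : 0 < e < 1 -> 0 <= p <= 1 -> 0 <= q <= 1 ->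
  push_spec e p q a b -> 0 <= a <= 1 /\ 0 <= b <= 1.
Proof.
move=> /andP[e0 e1] /andP[p0 p1] /andP[q0 q1].
by move=> [[h1 -> ->]|[h1 h2 -> ->]|[h1 -> ->]]; split; apply/andP; split; nra.
Qed.

Lemma push_spec_surj e a b : 0 < e < 1 -> 0 <= a <= 1 -> 0 <= b <= 1 ->
  exists p q, [/\ 0 <= p <= 1, 0 <= q <= 1 & push_spec e p q a b].
Proof.
move=> /andP[e0 e1] /andP[a0 a1] /andP[b0 b1].
have i0 : 0 < (1 + e)^-1 by rewrite invr_gt0; lra.
have i1 : (1 + e) * (1 + e)^-1 = 1 by rewrite mulfV //; apply/eqP; lra.
have j0 : 0 < (1 - e)^-1 by rewrite invr_gt0; lra.
have j1 : (1 - e) * (1 - e)^-1 = 1 by rewrite mulfV //; apply/eqP; lra.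
move: i0 i1 j0 j1; set i := (1 + e)^-1; set j := (1 - e)^-1 => i0 i1 j0 j1.
have [h|h] := leP b a.
  exists a, (b * i); split; [by rewrite a0|apply/andP; split; nra|apply: Or31].
  by have -> : (1 + e) * (b * i) = b by rewrite mulrCA i1 mulr1.
have [h2|h2] := leP ((1 - e) * b) a.
  have E : (1 + e) * ((2 * b - a) * i) = 2 * b - a by rewrite mulrCA i1 mulr1.
  exists b, ((2 * b - a) * i); split; [by rewrite b0|apply/andP; split; nra|apply: Or32].
  by split; rewrite ?E //; nra.
have E : (1 - e) * (a * j) = a by rewrite mulrCA j1 mulr1.
exists (a * j), b; split; [apply/andP; split; nra|by rewrite b0|apply: Or33].
by split; rewrite ?E //; nra.
Qed.

(** For a fixed first output, the first input is a 1-Lipschitz function of the second output. Hence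
    differences between carried values cannot shrink along the chain of pushes. *)
Lemma push_spec_lip e p q p' q' a b b' : 0 < e < 1 -> 0 <= p -> 0 <= p' ->
  push_spec e p q a b -> push_spec e p' q' a b' -> `|p - p'| <= `|b - b'|.
Proof.
move=> e01 p0 p0'.
wlog pp : p q b p' q' b' p0 p0' / p' <= p => [H s s'|s s'].
  have /orP[h|h] := le_total p' p; first exact: H s s'.
  by rewrite distrC [leRHS]distrC; exact: H s' s.
have [->|np] := eqVneq p p'; first by rewrite subrr normr0.
have {np}lt : p' < p by rewrite lt_neqAle eq_sym np.
rewrite ger0_norm ?subr_ge0 //; apply: le_trans (ler_norm _).
move: e01 => /andP[e0 e1].
have l1 : 0 < (1 - e) * (p - p') by apply: mulr_gt0; lra.
have ep' : 0 <= e * p' by apply: mulr_ge0 => //; exact: ltW.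
move: l1 s s'; rewrite /push_spec !mulrBl !mulrBr !mulrDl !mul1r => l1.
by move=> [[h1 -> ->]|[h1 h2 -> ->]|[h1 -> ->]] [[k1 A ->]|[k1 k2 A ->]|[k1 A ->]]; first [lra|nra].
Qed.

Lemma push2_norm_eq e x y p' q' : 0 < e < 1 -> push_spec e `|x| `|y| p' q' ->
  `|Num.sg y * q'| = q'.
Proof.
move=> e01 s; have [_ h] := push_spec_eq0 e01 (normr_ge0 x) (normr_ge0 y) s.
rewrite normrM normr_sg; have [y0|y0] := eqVneq y 0.
  by rewrite mul0r; move: h; rewrite normr_eq0 y0 eqxx => /eqP ->.
rewrite mul1r ger0_norm //; move: s => [[h1 _ ->]|[h1 h2 _ ->]|[h1 _ ->]] //.
by apply: mulr_ge0 => //; lra.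
Qed.

Lemma push1_norm_eq e x y p' q' : 0 < e < 1 -> push_spec e `|x| `|y| p' q' ->
  `|Num.sg x * p'| = p'.
Proof.
move=> e01 s; have [h _] := push_spec_eq0 e01 (normr_ge0 x) (normr_ge0 y) s.
rewrite normrM normr_sg; have [y0|y0] := eqVneq x 0.
  by rewrite mul0r; move: h; rewrite normr_eq0 y0 eqxx => /eqP ->.
have := normr_ge0 x; have := normr_ge0 y; move: e01 => /andP[e0 e1] q0 p0.
rewrite mul1r ger0_norm //; move: s => [[h1 -> _]|[h1 h2 -> _]|[h1 -> _]] //; nra.
Qed.

Lemma push_norm e x y : 0 < e < 1 -> `|x| <= 1 -> `|y| <= 1 ->
  `|push1 e x y| <= 1 /\ `|push2 e x y| <= 1.
Proof.
move=> e01 x1 y1; have [p' [q' [s -> ->]]] := pushP x y e01.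
rewrite (push1_norm_eq e01 s) (push2_norm_eq e01 s).
by case: (push_spec_itv e01 _ _ s); rewrite ?normr_ge0 // => /andP[_ ->] /andP[_ ->].
Qed.

Lemma push_surj e w z : 0 < e < 1 -> `|w| <= 1 -> `|z| <= 1 ->
  exists x y, [/\ `|x| <= 1, `|y| <= 1, push1 e x y = w & push2 e x y = z].
Proof.
move=> e01 w1 z1.
have [||p [q [p1 q1 s]]] := @push_spec_surj e `|w| `|z| e01; rewrite ?normr_ge0 //.
have [p0 q0] : 0 <= p /\ 0 <= q by move: p1 q1 => /andP[-> _] /andP[-> _].
have [hp hq] := push_spec_eq0 e01 p0 q0 s.
have np : `|Num.sg w * p| = p.
  rewrite normrM normr_sg (ger0_norm p0); have [w0|_] := eqVneq w 0; last by rewrite mul1r.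
  by move: hp; rewrite w0 normr0 eqxx mul0r => /esym/eqP.
have nq : `|Num.sg z * q| = q.
  rewrite normrM normr_sg (ger0_norm q0); have [z0|_] := eqVneq z 0; last by rewrite mul1r.
  by move: hq; rewrite z0 normr0 eqxx mul0r => /esym/eqP.
exists (Num.sg w * p), (Num.sg z * q).
have [p' [q' [s' -> ->]]] := pushP (Num.sg w * p) (Num.sg z * q) e01.
rewrite np nq in s' *; have [-> ->] := push_spec_uniq e01 p0 q0 s' s.
move: p1 q1 => /andP[_ ->] /andP[_ ->]; split => //.
  rewrite sgrM sgr_id; have [w0|w0] := eqVneq w 0; first by rewrite w0 sgr0 !mul0r.
  have pn : p != 0 by rewrite -hp normr_eq0.
  by rewrite (gtr0_sg (x := p)) ?mulr1 -?numEsg // lt0r pn.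
rewrite sgrM sgr_id; have [w0|w0] := eqVneq z 0; first by rewrite w0 sgr0 !mul0r.
have pn : q != 0 by rewrite -hq normr_eq0.
by rewrite (gtr0_sg (x := q)) ?mulr1 -?numEsg // lt0r pn.
Qed.

Lemma push_lip e x y x' y' : 0 < e < 1 -> push1 e x y = push1 e x' y' ->
  `|x - x'| <= `|push2 e x y - push2 e x' y'|.
Proof.
move=> e01; have [p [q [s -> ->]]] := pushP x y e01.
have [p' [q' [s' -> ->]]] := pushP x' y' e01 => pp.
apply: le_trans (ler_dist_dist _ _).
rewrite (push2_norm_eq e01 s) (push2_norm_eq e01 s').
have E : p = p' by rewrite -(push1_norm_eq e01 s) -(push1_norm_eq e01 s') pp.
rewrite -E in s' pp; have l := push_spec_lip e01 (normr_ge0 x) (normr_ge0 x') s s'.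
have [h _] := push_spec_eq0 e01 (normr_ge0 x) (normr_ge0 y) s.
have [h' _] := push_spec_eq0 e01 (normr_ge0 x') (normr_ge0 y') s'.
apply: le_trans l; have [p0|p0] := eqVneq p 0.
  move: h h'; rewrite p0 eqxx !normr_eq0 => /esym/eqP -> /esym/eqP ->.
  by rewrite subrr normr0.
have sg : Num.sg x = Num.sg x' by apply: (mulIf p0).
have -> : x - x' = Num.sg x * (`|x| - `|x'|) by rewrite mulrBr -numEsg sg -numEsg.
by rewrite normrM normr_sg; case: (x == 0); rewrite /= ?mul0r ?mul1r.
Qed.

Lemma push_spec_inj e p q q' a b : 0 < e < 1 ->
  push_spec e p q a b -> push_spec e p q' a b -> q = q'.
Proof.
move=> /andP[e0 e1].
by move=> [[h1 A B]|[h1 h2 A B]|[h1 A B]] [[k1 C D]|[k1 k2 C D]|[k1 C D]]; nra.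
Qed.

Lemma push2_inj e x y y' : 0 < e < 1 ->
  push1 e x y = push1 e x y' -> push2 e x y = push2 e x y' -> y = y'.
Proof.
move=> e01; have [a [b [s -> ->]]] := pushP x y e01.
have [a' [b' [s' -> ->]]] := pushP x y' e01 => /(congr1 Num.norm).
rewrite (push1_norm_eq e01 s) (push1_norm_eq e01 s') => aa bb.
have E : b = b' by rewrite -(push2_norm_eq e01 s) -(push2_norm_eq e01 s') bb.
rewrite -aa -E in s' bb; have q := push_spec_inj e01 s s'.
have [_ h] := push_spec_eq0 e01 (normr_ge0 x) (normr_ge0 y) s.
have [b0|b0] := eqVneq b 0.
  have y0 : y = 0 by apply/eqP; rewrite -normr_eq0 -h b0.
  by apply/esym/eqP; rewrite y0 -normr_eq0 -q y0 normr0.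
have sg : Num.sg y = Num.sg y' by apply: (mulIf b0).
by rewrite (numEsg y) (numEsg y') sg q.
Qed.

Lemma push1_close e x y : 0 < e < 1 -> `|x| <= 1 -> `|x - push1 e x y| <= e.
Proof.
move=> e01 x1; have [p [q [s -> _]]] := pushP x y e01.
have -> : x - Num.sg x * p = Num.sg x * (`|x| - p) by rewrite mulrBr -numEsg.
rewrite normrM normr_sg.
have h : `| `|x| - p| <= e.
  have := normr_ge0 x; have := normr_ge0 y; move: e01 => /andP[e0 e1] q0 p0.
  by move: s => [[h1 -> _]|[h1 h2 -> _]|[h1 -> _]]; rewrite ler_norml; apply/andP; split; nra.
by case: (x == 0); rewrite /= ?mul0r ?mul1r //; move: e01 => /andP[/ltW].
Qed.

(** As soon as [b] exceeds (1 + e)^-1 the bound is below 1: a second coordinate far from 0 moves the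
    first one off the end points. *)
Lemma push1_lt1 e x y b : 0 < e < 1 -> `|x| <= 1 -> b <= `|y| ->
  `|push1 e x y| <= Num.max (1 - e) (2 - (1 + e) * b).
Proof.
move=> e01 x1 yb; have [p [q [s -> _]]] := pushP x y e01.
rewrite (push1_norm_eq e01 s) le_max; move: e01 => /andP[e0 e1].
have := normr_ge0 x; have := normr_ge0 y => q0 p0.
by move: s => [[h1 -> _]|[h1 h2 -> _]|[h1 -> _]]; apply/orP; [right|right|left]; nra.
Qed.

Lemma push1_continuous (S : topologicalType) e (x y : S -> R) :
  continuous x -> continuous y -> continuous (fun s => push1 e (x s) (y s)).
Proof.
move=> cx cy; have cn := continuous_normr cy.
have ca := continuous_scaler (a := 1 - e) cx; have cb := continuous_scaler (a := 1 + e) cn.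
have c2 := continuous_scaler (a := 2) cx.
apply: continuous_subr => //; apply: continuous_addr.
  apply: continuous_maxr => //; apply: continuous_minr => //.
  exact: continuous_subr.
apply: continuous_minr => //; apply: continuous_maxr => //.
exact: continuous_addr.
Qed.

Lemma push2_continuous (S : topologicalType) e (x y : S -> R) :
  continuous x -> continuous y -> continuous (fun s => push2 e (x s) (y s)).
Proof.
move=> cx cy; have cn := continuous_normr cx; have ca := continuous_scaler (a := 1 + e) cy.
apply: continuous_subr => //; apply: continuous_addr.
  by apply: continuous_maxr => //; exact: continuous_minr.
apply: continuous_minr => //; apply: continuous_maxr => //.
under eq_fun do rewrite -mulN1r; exact: continuous_scaler.
Qed.

End push.

(** * The infinite composition of pushes *)

Section push_chain.
Variable R : realType.
Local Notation Q := (hilbert_cube R).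

(** The rates tend to 0, which is what makes the infinite composition injective in [carry_inj]. *)
Definition push_rate n : R := n.+2%:R^-1.

Lemma push_rate01 n : 0 < push_rate n < 1.
Proof. by rewrite /push_rate invr_gt0 ltr0n /= invf_lt1 ?ltr0n // ltr1n. Qed.

(* [push] is applied to the coordinates [(0, 1)], [(1, 2)], ... in turn:
   [carry x n] is the value of coordinate [n] in between, [pushed x n] its final
   value. *)
Fixpoint carry (x : Q) n : R :=
  if n is m.+1 then push2 (push_rate m) (carry x m) (jcoord x m.+1)
  else jcoord x 0.

Definition pushed (x : Q) n : R :=
  push1 (push_rate n) (carry x n) (jcoord x n.+1).

Lemma carry_norm x n : `|carry x n| <= 1.
Proof.
elim: n => [|n IH] /=; first exact: jcoord_norm.
by case: (push_norm (push_rate01 n) IH (jcoord_norm x n.+1)).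
Qed.

Lemma pushed_norm x n : `|pushed x n| <= 1.
Proof. by case: (push_norm (push_rate01 n) (carry_norm x n) (jcoord_norm x n.+1)). Qed.

Lemma carry_continuous n : continuous (fun x => carry x n).
Proof.
elim: n => [|n IH] /=; first exact: jcoord_continuous.
by apply: push2_continuous => //; exact: jcoord_continuous.
Qed.

Lemma pushed_continuous n : continuous (fun x => pushed x n).
Proof. by apply: push1_continuous; [exact: carry_continuous|exact: jcoord_continuous]. Qed.

Lemma eq_carry x y n : (forall m, (m <= n)%N -> jcoord x m = jcoord y m) ->
  carry x n = carry y n.
Proof.
elim: n => [|n IH] xy /=; first exact: xy.
by rewrite IH ?xy // => m mn; apply: xy; exact: leqW.
Qed.

(* Given the final values, [carry _ n] is a 1-Lipschitz function of
   [carry _ m] for [n <= m], and [carry _ m] varies by at most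
   [2 * push_rate m]. *)
Lemma carry_inj x y : (forall n, pushed x n = pushed y n) ->
  forall n, carry x n = carry y n.
Proof.
move=> xy n; have lip m : `|carry x m - carry y m| <= `|carry x m.+1 - carry y m.+1|.
  exact: push_lip (push_rate01 m) (xy m).
have mono m : (n <= m)%N -> `|carry x n - carry y n| <= `|carry x m - carry y m|.
  elim: m => [|m IH]; first by rewrite leqn0 => /eqP ->.
  rewrite leq_eqVlt => /orP[/eqP ->//|nm]; exact: le_trans (IH nm) (lip m).
have small m : `|carry x m - carry y m| <= 2 * push_rate m.
  have := push1_close (jcoord x m.+1) (push_rate01 m) (carry_norm x m).
  have := push1_close (jcoord y m.+1) (push_rate01 m) (carry_norm y m).
  rewrite -!/(pushed _ _) xy; set w := pushed y m; set r := push_rate m.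
  by rewrite !ler_norml; lra.
apply/eqP; rewrite -subr_eq0 -normr_le0; apply/ler_addgt0Pr => d d0; rewrite add0r.
pose m := maxn n (Num.truncn (2 / d)).
apply: le_trans (mono m (leq_maxl _ _)) _; apply: le_trans (small m) _.
rewrite /push_rate ler_pdivrMr ?ltr0n // mulrC -ler_pdivrMr //.
have := truncnS_gt (2 / d); set k := Num.truncn _ => h.
apply: ltW; apply: lt_le_trans h _; rewrite ler_nat ltnS /m.
exact: leq_trans (leq_maxr _ _) (leqnSn _).
Qed.

(** The chain is solved backwards: [push_surj] turns the wanted carry N + 1 and final value N into a
    carry N and a coordinate N + 1. As every prefix is attained, the range of the chain is dense. *)
Lemma pushed_prefix N z (w : Q) : `|z| <= 1 -> exists x : Q,
  carry x N = z /\ forall n, (n < N)%N -> pushed x n = jcoord w n.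
Proof.
elim: N z => [|N IH] z z1; first by exists (jmk (fun=> z)); rewrite /= jcoord_mk.
have [y [t [y1 t1 yt1 yt2]]] := push_surj (push_rate01 N) (jcoord_norm w N) z1.
have [x [xy xw]] := IH y y1.
pose f n := if n == N.+1 then t else jcoord x n.
have f1 n : `|f n| <= 1 by rewrite /f; case: ifP => // _; exact: jcoord_norm.
have fx n : (n <= N)%N -> jcoord (jmk f) n = jcoord x n.
  by move=> nN; rewrite jcoord_mk // /f ltn_eqF // ltnS.
have fN : jcoord (jmk f) N.+1 = t by rewrite jcoord_mk // /f eqxx.
have cN n : (n <= N)%N -> carry (jmk f) n = carry x n.
  by move=> nN; apply: eq_carry => m mn; apply: fx; exact: leq_trans mn nN.
exists (jmk f); split; first by rewrite [LHS]/= cN // xy fN.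
move=> n; rewrite ltnS leq_eqVlt => /orP[/eqP ->|nN].
  by rewrite /pushed cN // xy fN.
by rewrite /pushed cN ?(ltnW nN) // fx // -/(pushed x n) xw.
Qed.

(** Surjectivity holds because the range is dense and, by compactness, closed. *)
Lemma push_homeomorphism : homeomorphism (fun x : Q => jmk (pushed x)).
Proof.
set h := fun x : Q => jmk (pushed x).
have ch : continuous h by apply: jmk_continuous; exact: pushed_continuous.
have hI : injective h.
  move=> x y xy; have p n : pushed x n = pushed y n.
    by have := congr1 (fun x => jcoord x n) xy; rewrite !jcoord_mk ?pushed_norm.
  have c := carry_inj p; apply: jcoord_inj => -[|n]; first exact: c 0%N.
  have := c n.+1; have := p n; rewrite /pushed /= c => p1 p2.
  exact: push2_inj (push_rate01 n) p1 p2.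
have clh : closed (range h).
  apply: compact_closed; first exact: cube_hausdorff.
  apply: continuous_compact; first exact: continuous_subspaceT.
  exact: cube_compact.
have hS w : exists x, h x = w.
  suff : range h w by move=> [x _ <-]; exists x.
  rewrite ((closure_id _).1 clh) => U /prod_nbhs_prefix[N UN].
  have [x [_ xw]] := @pushed_prefix N 0 w ltac:(by rewrite normr0).
  exists (h x); split; first exact: imageT.
  apply: UN => n nN; apply: val_inj.
  have E : jcoord (h x) n = jcoord w n by rewrite jcoord_mk ?pushed_norm ?xw.
  suff : coord (h x) n = coord w n by [].
  by move: E; rewrite /jcoord; lra.
have /choice[g gP] := hS.
by apply: (@compact_homeomorphism _ _ h g) => //;
  [exact: cube_compact|exact: cube_hausdorff|move=> x; apply: hI].
Qed.

End push_chain.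

(** * Minimal Cantor sets *)

Section tame.
Variable R : realType.
Local Notation Q := (hilbert_cube R).

(** [slide_inv] centres each gap at 0, and a dilation then widens it as much as desired. *)
Lemma gap_homeomorphism (A : set Q) (c r b : nat -> R) :
  (forall n, `|c n| < 1) -> (forall n, 0 < r n) -> (forall n, b n < 1) ->
  (forall x n, A x -> r n <= `|jcoord x n - c n|) ->
  exists2 h : Q -> Q, homeomorphism h &
    forall x n, A x -> b n <= `|jcoord (h x) n|.
Proof.
(* [slide_inv] at worst halves the distance to the centre, so values stay at distance [r n / 2] from
   0. This [d n] then makes the dilated norm at least 1 / (2 - [b n]), which is at least [b n]. *)
move=> c1 r0 b1 Ar; pose d n := r n / 2 * (1 - b n).
have d0 n : 0 < d n by rewrite mulr_gt0 ?divr_gt0 // subr_gt0.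
exists ((fun x => jmk (fun n => dilate (d n) (jcoord x n))) \o
        (fun x => jmk (fun n => slide_inv (c n) (jcoord x n)))).
  by apply: homeomorphism_comp; [exact: slide_homeomorphism|exact: dilate_homeomorphism].
move=> x n Ax /=; have x1 := jcoord_norm x n.
rewrite jcoord_mk ?dilate_norm ?jcoord_norm //.
rewrite jcoord_mk ?slide_inv_norm //; set u := slide_inv _ _.
have u1 : `|u| <= 1 by exact: slide_inv_norm.
rewrite norm_dilate // ler_pdivlMr ?dilate_den //.
have ur : r n / 2 <= `|u|.
  have := c1 n; rewrite ltr_norml => /andP[c2 c3].
  have i0 : 0 < 1 - c n by lra.
  have i1 : 0 < 1 + c n by lra.
  have := Ar x n Ax; rewrite /u /slide_inv; have [t0|t0] := leP 0 (jcoord x n - c n).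
    rewrite mul0r addr0 ger0_norm // => h.
    have h0 : 0 <= (jcoord x n - c n) / (1 - c n) by apply: divr_ge0 => //; exact: ltW.
    by rewrite ger0_norm // ler_pdivlMr //; nra.
  rewrite mul0r add0r ltr0_norm // => h.
  by rewrite ltr0_norm ?pmulr_llt0 ?invr_gt0 // -mulNr ler_pdivlMr //; nra.
have r0n := r0 n; have b1n := b1 n.
have : d n * (1 - `|u|) <= `|u| * (1 - b n).
  rewrite /d; have k : r n / 2 * (1 - b n) <= `|u| * (1 - b n) by rewrite ler_pM2r ?subr_gt0.
  apply: le_trans k; rewrite (ger_pMr _ (d0 n)) gerBl //.
have : 0 <= d n * (1 - `|u|) by rewrite mulr_ge0 ?subr_ge0 // ltW.
set a := d n * _; have := normr_ge0 u; move: b1n; set v := `|u|; set w := b n; nra.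
Qed.

(** The target is the same for every tame [f], parameter by parameter, so one such homeomorphism
    followed by the inverse of another matches any two tame Cantor sets. *)
Lemma tame_homeomorphism (f : cantor_space -> Q) (c r : nat -> R) :
  continuous f -> injective f ->
  (forall n, `|c n| < 1) -> (forall n, 0 < r n) ->
  (forall x n, r n <= `|jcoord (f x) n - c n|) ->
  exists2 h : Q -> Q, homeomorphism h & forall x, h (f x) = cantor_line R x.
Proof.
(* For 0 < e < 1 the product (1 + e) * (1 - e / 2) exceeds 1, as [push1_lt1] requires. Coordinate 0
   is never the second argument of a push. *)
move=> cf fI c1 r0 fr; pose b n : R := if n is m.+1 then 1 - push_rate R m / 2 else 0.
have b1 n : b n < 1.
  by case: n => [|n] /=; [exact: ltr01|have := push_rate01 R n; lra].
have fr' x n : range f x -> r n <= `|jcoord x n - c n| by move=> [y _ <-].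
have [h1 hh1 h1b] := gap_homeomorphism c1 r0 b1 fr'.
have hp := @push_homeomorphism R.
pose h2 := (fun x : Q => jmk (pushed x)) \o h1.
have hh2 : homeomorphism h2 by exact: homeomorphism_comp.
pose d n : R := Num.max (1 - push_rate R n) (2 - (1 + push_rate R n) * b n.+1).
have d1 n : d n < 1.
  rewrite /d gt_max /=; have /andP[e0 e1] := push_rate01 R n.
  by apply/andP; split; [lra|nra].
have h2d x n : (h2 @` range f) x -> `|jcoord x n| <= d n.
  move=> [y fy <-]; rewrite jcoord_mk ?pushed_norm //.
  by apply: push1_lt1; [exact: push_rate01|exact: carry_norm|exact: h1b].
have [h3 [hh3 h3P]] := straighten_homeomorphism d1 h2d.
have hh : homeomorphism (h3 \o h2) by exact: homeomorphism_comp.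
have cg : continuous ((h3 \o h2) \o f).
  by move=> x; apply: continuous_comp; [exact: cf|exact: hh.1].
have gI : injective ((h3 \o h2) \o f).
  have [k [_ hK _]] := homeomorphism_inv hh.
  by apply: inj_comp fI; exact: can_inj hK.
have im x : (h2 @` range f) (h2 (f x)) by exists (f x) => //; exact: imageT.
have [h4 hh4 h4P] := klee_homeomorphism cg gI
  (fun x => (h3P _ (im x)).1) (fun x => (h3P _ (im x)).2).
by exists (h4 \o (h3 \o h2)); [exact: homeomorphism_comp|exact: h4P].
Qed.

Lemma cantor_prefix_nbhs (x : cantor_space) N :
  nbhs x [set v : cantor_space | forall n, (n < N)%N -> v n = x n].
Proof.
elim: N => [|N IH]; first by apply: filterS (@filterT _ (nbhs x) _).
have xN : nbhs x [set v : cantor_space | v N = x N].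
  apply: (@prod_proj_continuous nat (fun=> bool) N x [set x N]).
  by rewrite nbhsE /=; exists [set x N] => //; split => //; exact: discrete_open.
apply: filterS (filterI IH xN) => v [vn vN] n.
by rewrite ltnS leq_eqVlt => /orP[/eqP ->|/vn].
Qed.

(* Used with [L] the finitely many points supported in a given initial segment:
   further digits are postponed until they cannot fill a gap. *)
Lemma finite_gap (g : cantor_space -> R) (L : seq cantor_space) : continuous g ->
  exists (a b : R) (p : nat), [/\ -1 < a, a < b, b < 1 &
    forall z x, z \in L -> (forall m, (m < p)%N -> x m = z m) ->
      g x <= a \/ b <= g x].
Proof.
move=> cg; elim: L => [|z L [a [b [p [a1 ab b1 H]]]]].
  by exists (- 2^-1), 2^-1, 0%N; split => //; lra.
have q0 : 0 < (b - a) / 4 by lra.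
have /prod_nbhs_prefix[N NP] : nbhs z (g @^-1` [set t | `|g z - t| < (b - a) / 4]).
  by apply: cg; exact: (@cvgr_dist_lt _ _ _ (nbhs (g z)) _ (fun t => t) (g z) cvg_id).
have [gz|gz] := leP (g z) ((a + b) / 2).
  exists ((a + 3 * b) / 4), b, (maxn p N); split=> [|||y x]; try lra.
  rewrite inE => /orP[/eqP ->|yL] xy.
    left; have /NP /= : forall n, (n < N)%N -> x n = z n.
      by move=> n nN; apply: xy; rewrite leq_max nN orbT.
    by rewrite ltr_norml; lra.
  by case: (H y x yL) => [m mp|h|h]; [apply: xy; rewrite leq_max mp|left; lra|right].
exists a, ((3 * a + b) / 4), (maxn p N); split=> [|||y x]; try lra.
rewrite inE => /orP[/eqP ->|yL] xy.
  right; have /NP /= : forall n, (n < N)%N -> x n = z n.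
    by move=> n nN; apply: xy; rewrite leq_max nN orbT.
  by rewrite ltr_norml; lra.
by case: (H y x yL) => [m mp|h|h]; [apply: xy; rewrite leq_max mp|left|right; lra].
Qed.

Definition padded n (g : {ffun 'I_n -> bool}) : cantor_space :=
  fun m => if insub m is Some k then g k else false.

Lemma paddedP n (x : cantor_space) :
  exists g : {ffun 'I_n -> bool}, forall m, padded g m = (m < n)%N && x m.
Proof.
exists [ffun k : 'I_n => x k] => m; rewrite /padded.
by case: insubP => [k -> <-|/negbTE ->]; rewrite ?ffunE.
Qed.

(** [s] writes digit k of its argument at position [p k] and zeros elsewhere. When the positions
    before [n i] are settled, [finite_gap], applied to the finitely many prefixes, yields a [p i]
    such that zeros in between leave a gap in coordinate i, whatever follows. *)
Lemma thin_cantor (f : cantor_space -> Q) : continuous f ->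
  exists (s : cantor_space -> cantor_space) (c r : nat -> R),
    [/\ continuous s, injective s, forall n, `|c n| < 1, forall n, 0 < r n &
        forall x n, r n <= `|jcoord (f (s x)) n - c n|].
Proof.
move=> cf.
have step (ni : nat * nat) : exists abp : R * R * nat,
    [/\ -1 < abp.1.1, abp.1.1 < abp.1.2, abp.1.2 < 1, (ni.1 <= abp.2)%N &
     forall x : cantor_space, (forall m, (ni.1 <= m < abp.2)%N -> x m = false) ->
       jcoord (f x) ni.2 <= abp.1.1 \/ abp.1.2 <= jcoord (f x) ni.2].
  case: ni => n i /=; have cg : continuous (fun x => jcoord (f x) i).
    exact: (fun x => @continuous_comp _ _ _ f (fun y => jcoord y i) x (cf x) (@jcoord_continuous R i (f x))).
  have [a [b [p [a1 ab b1 H]]]] := finite_gap [seq padded g | g : {ffun 'I_n -> bool}] cg.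
  exists (a, b, maxn n p); split => //=; first exact: leq_maxl.
  move=> x x0; have [g gP] := paddedP n x.
  apply: (H (padded g)); first by apply/mapP; exists g; rewrite ?mem_enum.
  move=> m mp; rewrite gP; have [//|nm] := ltnP m n.
  by rewrite x0 // nm /= leq_max mp orbT.
have [F FP] := choice step.
pose fix n i := if i is j.+1 then (F (n j, j)).2.+1 else 0%N.
pose p i := (F (n i, i)).2.
have np i : (n i <= p i)%N by case: (FP (n i, i)).
have pn i : n i.+1 = (p i).+1 by [].
have pS i : (p i < p i.+1)%N by rewrite -pn.
have pmono i j : (i < j)%N -> (p i < p j)%N by exact: (homo_ltn ltn_trans pS).
have pinj i j : p i = p j -> i = j.
  by move=> e; case: (ltngtP i j) => // /pmono; rewrite e ltnn.
have pltn k i : (k < i)%N -> (p k < n i)%N.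
  case: i => // i; rewrite pn !ltnS leq_eqVlt => /orP[/eqP ->//|/pmono].
  exact: ltnW.
have ip i : (i <= p i)%N by elim: i => // i IH; exact: leq_ltn_trans IH (pS i).
(* The search can stop at m because [k <= p k]. *)
pose s (x : cantor_space) : cantor_space := fun m => has (fun k => (p k == m) && x k) (iota 0 m.+1).
have sp x k : s x (p k) = x k.
  apply/hasP/idP => [[j _ /andP[/eqP /pinj ->]]//|xk].
  by exists k; rewrite ?eqxx // mem_iota /= add0n ltnS ip.
pose a i := (F (n i, i)).1.1; pose b i := (F (n i, i)).1.2.
exists s, (fun i => (a i + b i) / 2), (fun i => (b i - a i) / 2); split.
- move=> x U /prod_nbhs_prefix[N NU]; apply: filterS (cantor_prefix_nbhs x N) => y yx.
  apply: NU => m mN; apply: eq_in_has => k; rewrite mem_iota /= add0n ltnS => km.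
  by rewrite yx //; exact: leq_ltn_trans km mN.
- by move=> x y xy; apply/funext => k; rewrite -sp xy sp.
- by move=> i; case: (FP (n i, i)) => ? ? ? _ _; rewrite ltr_norml /a /b; lra.
- by move=> i; case: (FP (n i, i)) => ? ? ? _ _; rewrite /a /b; lra.
- move=> x i; case: (FP (n i, i)) => _ ab _ _ /= /(_ (s x)) H.
  have {H} : jcoord (f (s x)) i <= a i \/ b i <= jcoord (f (s x)) i.
    apply: H => m /andP[nm mp]; apply/hasPn => k _; apply/negP => /andP[/eqP pk _].
    move: nm mp; rewrite -pk; case: (ltngtP k i) => [ki|ki|->]; last by rewrite /p ltnn.
      by rewrite leqNgt pltn.
    by move=> _; rewrite ltnNge ltnW // pmono.
  by move: ab; rewrite -/(a i) -/(b i) => ab [h|h]; rewrite ler_normr; apply/orP; [right|left]; lra.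
Qed.

(** * Products of closed sets without interior *)

Section product.
Variable K : nat -> set R.
Hypothesis Kc : forall n, closed (K n).
Hypothesis K01 : forall n, K n `<=` `[0, 1].
Hypothesis K0 : forall n, K n 0.
Hypothesis K1 : forall n, K n 1.
Hypothesis Kn : forall n (a b : R), 0 <= a -> a < b -> b <= 1 ->
  exists t, a < t < b /\ ~ K n t.

(** By Brouwer's characterisation of the Cantor space. Perfectness comes from the two points 0 and 1
    in each factor, which may have isolated points; zero-dimensionality comes from [Kn]. *)
Lemma cantor_product_param : exists f : cantor_space -> Q,
  [/\ continuous f, injective f & range f = [set x | forall n, K n (coord x n)]].
Proof.
have Kcpt n : compact (K n) by exact: (subclosed_compact (@Kc n) (@segment_compact R 0 1) (@K01 n)).
pose KT n : pseudoMetricType R := set_type (K n).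
have cT : cantor_like (prod_topology KT : topologicalType).
  split.
  - apply: perfect_diagonal => n.
    exists (exist _ 0 (mem_set (@K0 n)), exist _ 1 (mem_set (@K1 n))).
    by apply/eqP => /(congr1 set_val) /= /eqP; rewrite eq_sym oner_eq0.
  - have := @tychonoff nat KT (fun _ => setT) (fun n => set_type_compact (Kcpt n)).
    by congr (compact _); rewrite eqEsubset.
  - apply: hausdorff_product => n; apply: set_type_hausdorff; exact: Rhausdorff.
  - apply: zero_dimension_prod => n x y xy.
    have cv : continuous (set_val   : KT n -> R) by exact: initial_continuous.
    have sep (u v   : KT n) : set_val u < set_val v -> exists U : set (KT n), [/\ clopen U, U u & ~ U v].
      move=> uv; have := @K01 n _ (set_valP u); have := @K01 n _ (set_valP v).
      rewrite /= !in_itv /= => /andP[v0 v1] /andP[u0 u1].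
      have [t [/andP[ut tv] nt]] := @Kn n _ _ u0 uv v1.
      exists (set_val @^-1` [set z | z < t]); split => //=; last by apply/negP; rewrite -leNgt ltW.
      split; first by apply: open_comp; [move=> z _; exact: cv|exact: open_lt].
      rewrite (_ : set_val @^-1` _ = set_val @^-1` [set z | z <= t]).
        by apply: preimage_closed; [move=> z _; exact: cv|exact: closed_le].
      rewrite eqEsubset; split => z /= => [/ltW //|]; rewrite le_eqVlt => /orP[/eqP zt|//].
      by case: nt; rewrite -zt; exact: set_valP.
    have : set_val x != set_val y by apply: contra_neq xy => /val_inj.
    rewrite neq_lt => /orP[/sep //|/sep[U [cU Uy nUx]]].
    exists (~` U); split => //; first by case: cU => oU clU; split; [exact: closed_openC|exact: open_closedC].
pose P : pseudoMetricType R := prod_topology KT.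
pose p : P := fun n => exist _ (0:R) (mem_set (@K0 n)).
pose T : pseudoPMetricType R := HB.pack (P : Type) (isPointed.Build (P : Type) p) P.
have [g [cg _]] := @homeomorphism_cantor_like R T cT.
have gI : injective g by move=> x y; apply: (@inj _ _ setT g); rewrite inE.
have gS t : exists x, g x = t by have [x _ <-] := @surj _ _ setT setT g t I; exists x.
have K01' n (k   : KT n) : 0 <= set_val k <= 1.
  by have := @K01 n _ (set_valP k); rewrite /= in_itv.
pose phi (k : T) : Q := mk (fun n => set_val (k n)).
have phiE k n : coord (phi k) n = set_val (k n) by rewrite coord_mk.
pose f x := phi (g x).
have cf : continuous f.
  apply: mk_continuous => n x.
  apply: (@continuous_comp _ _ _ (fun x => g x n) set_val); last exact: initial_continuous.
  apply: (@continuous_comp _ _ _ g (fun k : T => k n)); first exact: cg.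
  exact: (@prod_proj_continuous nat KT n).
have fI : injective f.
  move=> x y xy; apply: gI; apply: functional_extensionality_dep => n; apply: val_inj.
  by rewrite -[LHS](phiE (g x) n) -[RHS](phiE (g y) n) [phi _]xy.
exists f; split => //; rewrite eqEsubset; split => [_ [x _ <-] n|x xK].
  by rewrite phiE; exact: set_valP.
pose y : P := fun n => exist _ (coord x n) (mem_set (xK n)).
have [z zE] := gS y.
by exists z => //; apply: coord_inj => n; rewrite phiE zE.
Qed.

Lemma minimal_cantor_product :
  minimal_cantor_set [set x : Q | forall n, K n (coord x n)].
Proof.
have [f [cf fI fr]] := cantor_product_param.
rewrite -fr; split; first by apply: cantor_set_range => //; exact: cube_hausdorff.
move=> B /cantor_set_param[u [cu uI uB]].
have [s [c [r [cs sI c1 r0 us]]]] := thin_cantor cu.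
have gap n : exists cr : R * R, [/\ `|cr.1| < 1, 0 < cr.2 &
    forall t, K n t -> cr.2 <= `|2 * t - 1 - cr.1|].
  have [t [/andP[t0 t1] nt]] := @Kn n 0 1 (lexx 0) ltr01 (lexx 1).
  have : nbhs t (~` K n) by apply: open_nbhs_nbhs; split => //; exact: closed_openC.
  move=> /nbhs_ballP[e /= e0 eK]; exists (2 * t - 1, 2 * e); split => /=.
  - by rewrite ltr_norml; lra.
  - by rewrite mulr_gt0.
  - move=> k Kk; rewrite leNgt; apply/negP => h; apply: (eK k) Kk.
    rewrite /ball /= distrC; move: h.
    have -> : 2 * k - 1 - (2 * t - 1) = 2 * (k - t) by ring.
    by rewrite normrM ger0_norm // ltr_pM2l.
have [cr crP] := choice gap.
have [hA hhA hAE] : exists2 h : Q -> Q, homeomorphism h & forall x, h (f x) = cantor_line R x.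
  apply: (@tame_homeomorphism f (fun n => (cr n).1) (fun n => (cr n).2)) => //.
  - by move=> n; case: (crP n).
  - by move=> n; case: (crP n).
  - move=> x n; case: (crP n) => _ _; apply.
    have : range f (f x) by exact: imageT.
    by rewrite fr.
have [hB hhB hBE] : exists2 h : Q -> Q, homeomorphism h & forall x, h (u (s x)) = cantor_line R x.
  apply: (@tame_homeomorphism (u \o s) c r) => //; last exact: inj_comp.
  by move=> x; apply: continuous_comp; [exact: cs|exact: cu].
have [k [hk hBK _]] := homeomorphism_inv hhB.
exists (k \o hA); first exact: homeomorphism_comp.
move=> _ [_ [x _ <-] <-] /=; rewrite hAE -hBE -uB hBK; exact: imageT.
Qed.

End product.

End tame.

(** * Binary codes of points *)

Section binary.
Variable R : realType.
Implicit Types (d e : nat -> bool) (t : R) (a b l : nat).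

Fixpoint dyadic d l : R :=
  if l is m.+1 then dyadic d m + (if d m then 2^-1 ^+ m.+1 else 0) else 0.

(** Closed inequalities admit both expansions of a dyadic number. Their strict form [prefix_open]
    forces the first l digits of every expansion. *)
Definition expands d t :=
  forall l, dyadic d l <= t <= dyadic d l + 2^-1 ^+ l.

Definition prefix_open d l : set R :=
  [set t | dyadic d l < t < dyadic d l + 2^-1 ^+ l].

Definition ragree a b d e := forall j, (a <= j < b)%N -> d j = e j.

Lemma half_gt0 l : 0 < 2^-1 ^+ l :> R.
Proof. by rewrite exprn_gt0. Qed.

Lemma halfS l : 2^-1 ^+ l.+1 = 2^-1 ^+ l / 2 :> R.
Proof. by rewrite exprSr. Qed.

Lemma half_lt t : 0 < t -> exists l, 2^-1 ^+ l < t.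
Proof.
move=> t0; have : (fun l => 2^-1 ^+ l : R) @ \oo --> 0.
  by apply: cvg_expr; rewrite ger0_norm ?invr_ge0 //; lra.
move=> /cvgrPdist_lt/(_ t t0)[N _ /(_ N (leqnn N))] /=.
by rewrite sub0r normrN ger0_norm ?exprn_ge0 // => h; exists N.
Qed.

Lemma half_le l m : (l <= m)%N -> 2^-1 ^+ m <= 2^-1 ^+ l :> R.
Proof. by move=> lm; apply: ler_wiXn2l => //; lra. Qed.

Lemma eq_dyadic d e l : ragree 0 l d e -> dyadic d l = dyadic e l.
Proof.
elim: l => // l IH de /=; rewrite IH ?de ?ltnSn //.
by move=> j /andP[_ jl]; apply: de; rewrite (leqW jl).
Qed.

Lemma dyadic_nested d l m : (l <= m)%N ->
  dyadic d l <= dyadic d m /\ dyadic d m + 2^-1 ^+ m <= dyadic d l + 2^-1 ^+ l.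
Proof.
elim: m => [|m IH]; first by rewrite leqn0 => /eqP ->.
rewrite leq_eqVlt => /orP[/eqP ->//|/IH[h1 h2]] /=.
by have := half_gt0 m; rewrite halfS; case: (d m); lra.
Qed.

Lemma expands_exists d : exists2 t, 0 <= t <= 1 & expands d t.
Proof.
have ub l : ubound (range (dyadic d)) (dyadic d l + 2^-1 ^+ l).
  move=> _ [m _ <-]; have := half_gt0 m; have := half_gt0 l.
  by have [lm|/ltnW ml] := leqP l m; have [] := dyadic_nested d (ltac:(eassumption)); lra.
have hs : has_sup (range (dyadic d)).
  by split; [exists (dyadic d 0%N), 0%N|exists (dyadic d 0 + 2^-1 ^+ 0)].
have E : expands d (sup (range (dyadic d))).
  move=> l; apply/andP; split; first by apply: ub_le_sup; [exact: hs.2|exists l].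
  by apply: ge_sup; [exact: hs.1|exact: ub].
by exists (sup (range (dyadic d))) => //; have := E 0%N; rewrite /= expr0 add0r.
Qed.

Lemma expansion_exists t : 0 <= t <= 1 -> exists d, expands d t.
Proof.
move=> t01; pose fix p l : R :=
  if l is m.+1 then p m + (if p m + 2^-1 ^+ m.+1 <= t then 2^-1 ^+ m.+1 else 0) else 0.
exists (fun l => p l + 2^-1 ^+ l.+1 <= t) => l.
have -> : dyadic (fun l => p l + 2^-1 ^+ l.+1 <= t) l = p l by elim: l => //= l ->.
elim: l => [|l IH] /=; first by rewrite expr0 add0r.
move: IH; rewrite halfS; have := half_gt0 l; set h := 2^-1 ^+ l => h0.
by case: (leP (p l + h / 2) t); lra.
Qed.

Lemma expands_prefix d e l t : expands d t -> prefix_open e l t -> ragree 0 l d e.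
Proof.
move=> dt; elim: l => [|l IH] et; first by move=> j; rewrite ltn0 andbF.
have de : ragree 0 l d e.
  apply: IH; have [h1 h2] := dyadic_nested e (leqnSn l).
  by move: et; rewrite /prefix_open /= in h1 h2 *; lra.
move=> j /andP[_]; rewrite ltnS leq_eqVlt => /orP[/eqP ->{j}|jl]; last exact: de.
have := dt l.+1; move: et; rewrite /prefix_open /= (eq_dyadic de) halfS.
by have := half_gt0 l; case: (d l); case: (e l) => //; lra.
Qed.

Lemma prefix_open_open d l : open (prefix_open d l).
Proof.
have -> : prefix_open d l = `]dyadic d l, dyadic d l + 2^-1 ^+ l[%classic.
  by apply/seteqP; split => t /=; rewrite in_itv.
exact: interval_open.
Qed.

Lemma prefix_openI d l t : prefix_open d l t -> 0 < t < 1.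
Proof.
have [/= h1 h2] := dyadic_nested d (leq0n l).
by rewrite /prefix_open /= in h1 h2 *; rewrite expr0 add0r in h2; lra.
Qed.

(** An open set of numbers all of whose expansions agree with [d] on [a, b). Its complement is
    closed and keeps 0 and 1, as products of minimal type require. *)
Definition hit d a b : set R :=
  [set t | exists2 e, ragree a b e d & prefix_open e b t].

Lemma hit_open d a b : open (hit d a b).
Proof.
have -> : hit d a b = \bigcup_(e in [set e | ragree a b e d]) prefix_open e b.
  by apply/seteqP; split => t; [move=> [e ? ?]; exists e|move=> [e ? ?]; exists e].
by apply: bigcup_open => e _; exact: prefix_open_open.
Qed.

Lemma hit_ragree d a b e t : hit d a b t -> expands e t -> ragree a b e d.
Proof.
move=> [f fd ft] et j /andP[aj jb]; rewrite (expands_prefix et ft) ?jb //.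
by rewrite fd // aj.
Qed.

(** The first [a] digits are those of the midpoint of (x, y) and the next ones those of [d]; the
    centre of the resulting dyadic interval is the point. *)
Lemma hit_dense d a b (x y : R) : 0 <= x -> x < y -> y <= 1 ->
  2^-1 ^+ a <= (y - x) / 2 -> (a <= b)%N -> exists t, x < t < y /\ hit d a b t.
Proof.
move=> x0 xy y1 ha ab.
have [e et] := @expansion_exists ((x + y) / 2) ltac:(lra).
pose f j := if (j < a)%N then e j else d j.
have fe : ragree 0 a f e by move=> j /andP[_ ja]; rewrite /f ja.
have [h1 h2] := dyadic_nested f ab; have b0 := half_gt0 b.
exists (dyadic f b + 2^-1 ^+ b / 2); split.
  by have := et a; rewrite (eq_dyadic fe) in h1 h2; lra.
exists f; last by rewrite /prefix_open /=; lra.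
by move=> j /andP[aj _]; rewrite /f ltnNge aj.
Qed.

End binary.

(** * Codes of points and of meager sets *)

Section cube_digits.
Variable R : realType.
Local Notation Q := (hilbert_cube R).
Implicit Types (x : Q) (y z : nat -> nat -> bool) (k u : nat -> nat).

Definition codes y x := forall i, expands (y i) (coord x i).

(** Square shells: a partition of the integers into intervals cuts a matrix into finite pieces. *)
Definition agree (a b : nat) y z :=
  forall i j, (a <= maxn i j < b)%N -> y i j = z i j.

Lemma codes_exists y : exists x, codes y x.
Proof.
have /choice[t tP] : forall i, exists t : R, 0 <= t <= 1 /\ expands (y i) t.
  by move=> i; have [t t01 E] := expands_exists R (y i); exists t.
exists (mk t) => i; have [t01 E] := tP i; by rewrite coord_mk.
Qed.

Lemma code_exists x : exists y, codes y x.
Proof.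
have /choice[y yP] : forall i, exists d, expands d (coord x i).
  by move=> i; apply: expansion_exists; exact: coord_itv.
by exists y.
Qed.

Definition box y l : set Q := [set x | forall i, (i < l)%N -> prefix_open (y i) l (coord x i)].

Lemma box_open y l : open (box y l).
Proof.
rewrite openE => x xb; rewrite /interior /=.
have H i : nbhs x [set v | (i < l)%N -> prefix_open (y i) l (coord v i)].
  have [il|il] := ltnP i l; last by apply: filterS (@filterT _ (nbhs x) _) => v _.
  have : nbhs x ((fun v => coord v i) @^-1` prefix_open (y i) l).
    apply: (@coord_continuous R i x); apply: open_nbhs_nbhs; split; last exact: xb.
    exact: prefix_open_open.
  by apply: filterS => v vP _; exact: vP.
have : nbhs x [set v | forall i, (i < l)%N -> (i < l)%N -> prefix_open (y i) l (coord v i)].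
  elim: {1}l => [|m IH]; first by apply: filterS (@filterT _ (nbhs x) _) => v.
  apply: filterS (filterI IH (H m)) => v [v1 v2] i.
  by rewrite ltnS leq_eqVlt => /orP[/eqP ->|/v1].
by apply: filterS => v vP i il; exact: vP.
Qed.

Lemma box_nonempty y l : box y l !=set0.
Proof.
exists (mk (fun i => dyadic R (y i) l + 2^-1 ^+ l / 2)) => i il.
have [/= h1 h2] := dyadic_nested R (y i) (leq0n l); have h0 := half_gt0 R l.
rewrite expr0 add0r in h2.
by rewrite /prefix_open /= coord_mk /=; lra.
Qed.

Lemma box_codes y z l x : box y l x -> codes z x -> agree 0 l z y.
Proof.
move=> xb zx i j /andP[_]; rewrite gtn_max => /andP[il jl].
exact: (expands_prefix (zx i) (xb i il) (j := j) jl).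
Qed.

Lemma cube_nbhs x U : nbhs x U -> exists N (e : R), 0 < e /\
  forall v : Q, (forall n, (n < N)%N -> `|coord v n - coord x n| < e) -> U v.
Proof.
move=> xU; apply: contrapT => H.
have /choice[v vP] : forall N, exists v : Q,
    (forall n, (n < N)%N -> `|coord v n - coord x n| < 2^-1 ^+ N) /\ ~ U v.
  move=> N; apply: contrapT => /forallNP HN; apply: H; exists N, (2^-1 ^+ N).
  split; first exact: half_gt0.
  by move=> v vN; apply: contrapT => Uv; apply: (HN v).
have vx : v @ \oo --> x.
  apply/cvg_sup => i A [B [[W oW <-] Wx WA]].
  have [W' oW' W'E] := oW; rewrite -W'E in WA Wx.
  have : nbhs (coord x i) W' by apply: open_nbhs_nbhs; split.
  move=> /nbhs_ballP[e /= e0 eW]; have [l le] := half_lt e0.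
  exists (maxn i.+1 l) => // N /=; rewrite geq_max => /andP[iN lN].
  apply: WA; apply: eW; rewrite /ball /= distrC.
  by apply: lt_le_trans ((vP N).1 i iN) _; apply: le_trans (ltW le); exact: half_le.
by move: (vx U xU) => [N _ /(_ N (leqnn N))]; exact: (vP N).2.
Qed.

Lemma codes_nbhs x y U : nbhs x U -> codes y x ->
  exists l, forall v z, codes z v -> agree 0 l z y -> U v.
Proof.
move=> /cube_nbhs[N [e [e0 H]]] yx; have [l le] := half_lt e0.
exists (maxn N l) => v z zv zy; apply: H => n nN.
have zyn : ragree 0 l (z n) (y n).
  by move=> j /andP[_ jl]; apply: zy; rewrite gtn_max !leq_max nN jl orbT.
have := zv n l; have := yx n l; rewrite (eq_dyadic R zyn).
by rewrite ltr_norml; lra.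
Qed.

Definition matrices l : seq (nat -> nat -> bool) :=
  [seq (fun i j => if (insub i, insub j) is (Some i', Some j') then g (i', j') else false)
     | g : {ffun 'I_l * 'I_l -> bool}].

Lemma matricesP l y : exists2 s, s \in matrices l & agree 0 l y s.
Proof.
pose g := [ffun ij : 'I_l * 'I_l => y ij.1 ij.2].
eexists; first by apply/mapP; exists g; rewrite ?mem_enum.
move=> i j /andP[_]; rewrite gtn_max => /andP[il jl] /=.
by rewrite !insubT /= ffunE.
Qed.

(** The box prescribed by [s] and then [z1] contains a point off the closure of [F]; a longer part
    of its code keeps every such point out of [F]. *)
Lemma avoid_one (F : set Q) l l1 s z1 : nowhere_dense F -> (l <= l1)%N ->
  exists l2 z2, [/\ (l1 <= l2)%N, agree l l1 z2 z1 &
    forall x y, codes y x -> agree 0 l y s -> agree l l2 y z2 -> ~ F x].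
Proof.
move=> ndF ll1; pose y1 i j := if (maxn i j < l)%N then s i j else z1 i j.
have [x [xb nFx]] : exists x, box y1 l1 x /\ ~ closure F x.
  apply: contrapT => /forallNP H; have [x xb] := box_nonempty y1 l1.
  have : (closure F)° x.
    apply: (@filterS _ (nbhs x) _ (box y1 l1)).
      by move=> v vb; apply: contrapT => nv; apply: (H v).
    by apply: open_nbhs_nbhs; split => //; exact: box_open.
  by rewrite ndF.
have [y2 y2x] := code_exists x.
have nx : nbhs x (~` closure F).
  by apply: open_nbhs_nbhs; split => //; apply: closed_openC; exact: closed_closure.
have [l2 l2P] := codes_nbhs nx y2x.
have y21 := box_codes xb y2x.
exists (maxn l1 l2), y2; split; first exact: leq_maxl.
  by move=> i j /andP[h1 h2]; rewrite y21 ?h2 // /y1 ltnNge h1.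
move=> v y yv ys yy2 Fv; apply: (l2P v y yv) (subset_closure Fv).
move=> i j /andP[_ h]; have [h1|h1] := ltnP (maxn i j) l.
  by rewrite ys ?h1 // y21 ?(leq_trans h1) // /y1 h1.
by apply: yy2; rewrite h1 leq_max h orbT.
Qed.

Lemma avoid_list (F : nat -> set Q) l (L : seq ((nat -> nat -> bool) * nat)) :
  (forall m, nowhere_dense (F m)) ->
  exists l2 z2, [/\ (l < l2)%N & forall x y, codes y x -> agree l l2 y z2 ->
    forall s m, (s, m) \in L -> agree 0 l y s -> ~ F m x].
Proof.
move=> ndF; elim: L => [|[s m] L [l1 [z1 [ll1 H]]]].
  by exists l.+1, (fun _ _ => false).
have [l2 [z2 [l12 z21 H2]]] := avoid_one s z1 (ndF m) (ltnW ll1).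
exists l2, z2; split; first exact: leq_trans ll1 l12.
move=> x y yx yz s' m'; rewrite inE => /orP[/eqP[-> ->]|L'].
  by move=> ys; exact: H2 yx ys yz.
apply: (H x y yx _ s' m' L') => i j /andP[h1 h2].
by rewrite yz ?h1 ?(leq_trans h2) // z21 ?h1.
Qed.

(** The index of the interval of the partition that contains m. Indices up to m suffice since
    [n <= k n]; below [k 0] the value is 0. *)
Definition block k m := find (fun n => (m < k n.+1)%N) (iota 0 m.+1).

Definition assemble k (zz : nat -> nat -> nat -> bool) i j :=
  zz (block k (maxn i j)) i j.

Lemma incr_lt k : (forall n, k n < k n.+1)%N -> forall m n, (m < n)%N -> (k m < k n)%N.
Proof. by move=> kS m n; exact: (homo_ltn ltn_trans kS). Qed.

Lemma incr_le k : (forall n, k n < k n.+1)%N -> forall m n, (m <= n)%N -> (k m <= k n)%N.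
Proof. by move=> kS m n; rewrite leq_eqVlt => /orP[/eqP ->//|/(incr_lt kS)/ltnW]. Qed.

Lemma incr_ge k : (forall n, k n < k n.+1)%N -> forall n, (n <= k n)%N.
Proof. by move=> kS; elim=> // n IH; exact: leq_ltn_trans IH (kS n). Qed.

Lemma blockE k n m : (forall n, k n < k n.+1)%N -> (k n <= m < k n.+1)%N -> block k m = n.
Proof.
move=> kS /andP[nm mn]; have nlem : (n < m.+1)%N by rewrite ltnS (leq_trans (incr_ge kS n)).
have -> : block k m = find (fun n => (m < k n.+1)%N) (iota 0 n ++ iota n (m.+1 - n)).
  by rewrite -[X in _ ++ iota X _]add0n -iotaD subnKC // ltnW.
rewrite find_cat size_iota.
case: hasP => [[i]|_].
  rewrite mem_iota add0n => /andP[_ ilt] mi; have := incr_le kS ilt.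
  by rewrite leqNgt (leq_ltn_trans nm mi).
have : (0 < m.+1 - n)%N by rewrite subn_gt0.
by case: (m.+1 - n)%N => //= q _; rewrite mn addn0.
Qed.

Lemma assemble_agree k zz n : (forall n, k n < k n.+1)%N ->
  agree (k n) (k n.+1) (assemble k zz) (zz n).
Proof. by move=> kS i j ij; rewrite /assemble (blockE kS ij). Qed.

Lemma meager_code (N : set Q) : meager N -> exists k z,
  (forall n, k n < k n.+1)%N /\ forall x y, codes y x ->
    (forall P, exists2 n, (P <= n)%N & agree (k n) (k n.+1) y z) -> ~ N x.
Proof.
move=> [F ndF ->].
have /choice[G GP] (ln : nat * nat) : exists lz : nat * (nat -> nat -> bool),
    (ln.1 < lz.1)%N /\ forall x y, codes y x -> agree ln.1 lz.1 y lz.2 ->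
      forall m, (m <= ln.2)%N -> ~ F m x.
  case: ln => l n /=.
  have [l2 [z2 [ll2 H]]] := avoid_list l [seq (s, m) | s <- matrices l, m <- iota 0 n.+1] ndF.
  exists (l2, z2); split => // x y yx yz m mn.
  have [s sl ys] := matricesP l y; apply: (H x y yx yz s m) => //.
  by apply/allpairsP; exists (s, m); rewrite sl mem_iota add0n ltnS mn.
pose fix k n := if n is m.+1 then (G (k m, m)).1 else 0%N.
have kS n : (k n < k n.+1)%N by case: (GP (k n, n)).
exists k, (assemble k (fun n => (G (k n, n)).2)); split => // x y yx H [m _ Fm].
have [n mn yn] := H m; have [_ /(_ x y yx)] := GP (k n, n) => /(_ _ m mn); apply => //.
by move=> i j ij; rewrite yn //; exact: assemble_agree.
Qed.

(* Block [r] only tests the rows [i <= r]: each row is still tested by almost all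
   blocks, while a guess read in block [r] comes from finitely many rows. *)
Definition evades u (Z : nat -> nat -> bool) : set Q :=
  [set x | exists M, forall r i, (M <= r)%N -> (i <= r)%N ->
     ~ hit (Z i) (u r) (u r.+1) (coord x i)].

(** For a fixed bound M the condition concerns each row separately, hence defines a product
    [A M]. *)
Lemma evades_sigma u Z : (forall n, u n < u n.+1)%N ->
  sigma_ideal (@minimal_cantor_set R) (evades u Z).
Proof.
move=> uS; pose K M i : set R := [set t | 0 <= t <= 1 /\
  forall r, (M <= r)%N -> (i <= r)%N -> ~ hit (Z i) (u r) (u r.+1) t].
pose A M : set Q := [set x | forall i, K M i (coord x i)].
exists (range A); last first.
  move=> x [M HM]; exists (A M); first by exists M.
  by move=> i; split; [exact: coord_itv|move=> r Mr ir; exact: HM].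
split; first exact: card_image_le.
move=> _ [M _ <-]; apply: minimal_cantor_product.
- move=> i; have -> : K M i = `[0, 1]%classic `&`
      \bigcap_(r in [set r | (M <= r)%N && (i <= r)%N]) ~` hit (Z i) (u r) (u r.+1).
    apply/seteqP; split => t /=; rewrite in_itv /=.
      by move=> [t01 H]; split => // r /andP[? ?]; exact: H.
    by move=> [t01 H]; split => // r Mr ir; apply: (H r); rewrite /= Mr.
  apply: closedI; first exact: interval_closed.
  by apply: closed_bigI => r _; apply: open_closedC; exact: hit_open.
- by move=> i t [t01 _]; rewrite /= in_itv.
- by move=> i; split=> [|r _ _ [e _ /prefix_openI]]; lra.
- by move=> i; split=> [|r _ _ [e _ /prefix_openI]]; lra.
- move=> i a b a0 ab b1; have [l lab] : exists l, 2^-1 ^+ l < (b - a) / 2 by apply: half_lt; lra.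
  pose r := maxn l (maxn M i).
  have lu : (l <= u r)%N by apply: leq_trans (incr_ge uS _); exact: leq_maxl.
  have [] := @hit_dense R (Z i) (u r) (u r.+1) a b a0 ab b1.
  + by apply: le_trans (ltW lab); exact: half_le.
  + exact/ltnW/uS.
  move=> t [tab ht]; exists t; split => // -[_ /(_ r)]; apply => //.
    by rewrite !leq_max leqnn orbT.
  by rewrite !leq_max leqnn !orbT.
Qed.

Lemma not_evades u Z x y : codes y x -> ~ evades u Z x -> forall M,
  exists r i, [/\ (M <= r)%N, (i <= r)%N & ragree (u r) (u r.+1) (y i) (Z i)].
Proof.
move=> yx nE M; apply: contrapT => H; apply: nE; exists M => r i Mr ir hx.
by apply: H; exists r, i; split => //; exact: hit_ragree hx (yx i).
Qed.

Lemma evadesI u Z x y : codes y x -> (exists M, forall r i, (M <= r)%N -> (i <= r)%N ->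
  ~ ragree (u r) (u r.+1) (y i) (Z i)) -> evades u Z x.
Proof.
move=> yx [M H]; exists M => r i Mr ir hx; apply: (H r i Mr ir).
exact: hit_ragree hx (yx i).
Qed.

End cube_digits.

(** * Combinatorics of meager sets *)

Section growth.
Implicit Types (F k h : nat -> nat).

Definition dominated h k := exists M, forall m, (M <= m)%N -> (h m <= k m)%N.

(** Its iterates from 0 form an interval partition in which each end point exceeds the values of [F]
    at all points up to the preceding one. *)
Definition envelope F u := (\max_(v < u.+1) F v + u).+1.

Definition orbit_of F p := iter p (envelope F) 0%N.

Lemma envelope_ge F u : (F u < envelope F u)%N.
Proof.
rewrite /envelope ltnS (leq_trans _ (leq_addr _ _)) //.
exact: (@leq_bigmax _ (fun v : 'I_u.+1 => F v) ord_max).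
Qed.

Lemma envelope_gt F u : (u < envelope F u)%N.
Proof. by rewrite /envelope ltnS leq_addl. Qed.

Lemma envelope_mono F u v : (u <= v)%N -> (envelope F u <= envelope F v)%N.
Proof.
move=> uv; rewrite /envelope ltnS leq_add //; apply/bigmax_leqP => i _.
have iv : (i < v.+1)%N by rewrite ltnS (leq_trans _ uv) // -ltnS.
exact: (@leq_bigmax _ (fun w : 'I_v.+1 => F w) (Ordinal iv)).
Qed.

Lemma orbit_of_incr F p : (orbit_of F p < orbit_of F p.+1)%N.
Proof. exact: envelope_gt. Qed.

Lemma interval_containing k m : (forall n, k n < k n.+1)%N -> k 0%N = 0%N ->
  exists n, (k n <= m < k n.+1)%N.
Proof.
move=> kS k0; have ex : exists n, (m < k n.+1)%N by exists m; exact: (incr_ge kS m.+1).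
case: (ex_minnP ex) => -[|n] mn nmin; first by exists 0%N; rewrite k0.
by exists n.+1; rewrite mn andbT leqNgt; apply/negP => /nmin; rewrite ltnn.
Qed.

(** If interval p of the orbit contains no interval of [k] as required, taking n to be its left end
    a(p) gives a(p+1) <= k(a(p)+1). Two such steps bound [F] on that interval, since F(m) <
    a(p+2). *)
Lemma contains_or_dominated F k : (forall n, k n < k n.+1)%N ->
  (forall P, exists2 p, (P <= p)%N &
     exists n, (orbit_of F p <= k n)%N && (k n.+1 < orbit_of F p.+1)%N) \/
  dominated F (fun m => k (k m.+1).+1).
Proof.
move=> kS; set a := orbit_of F; have aS : forall n, (a n < a n.+1)%N by exact: orbit_of_incr.
have [H|/existsNP[P /forall2NP H]] := pselect (forall P, exists2 p, (P <= p)%N &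
     exists n, (a p <= k n)%N && (k n.+1 < a p.+1)%N); first by left.
right; have aP p : (P <= p)%N -> (a p.+1 <= k (a p).+1)%N.
  move=> Pp; case: (H p) => // /forallNP/(_ (a p))/negP.
  by rewrite (incr_ge kS) /= -leqNgt.
exists (a P) => m Pm; have [p /andP[pm mp]] := interval_containing m aS erefl.
have Pp : (P <= p)%N.
  by rewrite leqNgt; apply/negP => /(incr_le aS); rewrite leqNgt (leq_ltn_trans Pm mp).
apply: leq_trans (ltnW (envelope_ge F m)) _.
apply: leq_trans (envelope_mono F (ltnW mp)) _.
apply: leq_trans (aP p.+1 (leqW Pp)) _.
apply: (incr_le kS); rewrite ltnS; apply: leq_trans (aP p Pp) _.
by apply: (incr_le kS); rewrite ltnS.
Qed.

End growth.

(** * Guesses read off binary rows *)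

Section guessing.

(** The number of zeros from u to the next one: finitely many digits thus encode an arbitrary
    natural number. Without a later one the value is 0. *)
Definition run (d : nat -> bool) u : nat :=
  xget 0%N [set c | d (u + c)%N /\ forall c', (c' < c)%N -> ~~ d (u + c')%N].

Lemma runE (d : nat -> bool) u c :
  ragree u (u + c).+1 d (fun j => j == u + c)%N -> run d u = c.
Proof.
move=> H; have d1 : d (u + c)%N by rewrite H ?eqxx // leq_addr ltnSn.
have d0 c' : (c' < c)%N -> ~~ d (u + c')%N.
  by move=> c'c; rewrite H ?eqn_add2l ?ltn_eqF // leq_addr ltnS leq_add2l ltnW.
have : exists c, [set c | d (u + c)%N /\ forall c', (c' < c)%N -> ~~ d (u + c')%N] c by exists c.
move=> /(xgetPex 0%N); rewrite -/(run d u) => -[r1 r0].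
case: (ltngtP (run d u) c) => // [/d0|/r0]; first by rewrite r1.
by rewrite d1.
Qed.

(** Block r is just long enough for c r u zeros and a final one, u being its start; [guess_pattern]
    is this string. *)
Fixpoint guess_seq (c : nat -> nat -> nat) r : nat :=
  if r is q.+1 then (guess_seq c q + c q (guess_seq c q)).+1 else 0%N.

Lemma guess_seq_incr c r : (guess_seq c r < guess_seq c r.+1)%N.
Proof. by rewrite /= ltnS leq_addr. Qed.

Definition guess_pattern (c : nat -> nat -> nat) (i j : nat) : bool :=
  j.+1 == guess_seq c (block (guess_seq c) j).+1.

End guessing.

Section guess_sets.
Variable R : realType.
Local Notation Q := (hilbert_cube R).
Local Notation sC0 := (sigma_ideal (@minimal_cantor_set R)).

Definition misguesses c : set Q := evades (guess_seq c) (guess_pattern c).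

Lemma misguesses_sigma c : sC0 (misguesses c).
Proof. by apply: evades_sigma; exact: guess_seq_incr. Qed.

Lemma not_misguesses c (x : Q) y : codes y x -> ~ misguesses c x -> forall M,
  exists r i, [/\ (M <= r)%N, (i <= r)%N & run (y i) (guess_seq c r) = c r (guess_seq c r)].
Proof.
move=> yx nx M; have [r [i [Mr ir H]]] := not_evades yx nx M.
exists r, i; split => //; apply: runE => j jr; rewrite H // /guess_pattern.
by rewrite (@blockE _ r j (guess_seq_incr c)) //= eqSS.
Qed.

(* The point constructed in the proof copies a code of [N] on the intervals that
   fit strictly inside a block, and has [true] in the last column of each block:
   its rows evade the zero string. *)
Lemma dominating_family : exists D : (nat -> nat) -> set Q,
  (forall h, sC0 (D h)) /\
  forall N, meager N -> exists k, forall h, D h `<=` N -> dominated h k.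
Proof.
exists (fun h => evades (orbit_of h) (fun _ _ => false)); split.
  by move=> h; apply: evades_sigma; exact: orbit_of_incr.
move=> N /meager_code[k [z [kS kz]]]; exists (fun m => k (k m.+1).+1) => h DN.
have [H|//] := contains_or_dominated h kS; exfalso.
pose a := orbit_of h; have aS : forall n, (a n < a n.+1)%N by exact: orbit_of_incr.
pose inside m q n := [/\ (a q <= k n)%N, (k n <= m < k n.+1)%N & (k n.+1 < a q.+1)%N].
pose y i j := if `[< exists q n, inside (maxn i j) q n >] then z i j else true.
have [x yx] := codes_exists R y.
apply: (kz x y yx).
  move=> P; have [p Pp [n /andP[an na]]] := H (k P); exists n.
    rewrite leqNgt; apply/negP => /(incr_lt kS); rewrite ltnNge.
    by rewrite (leq_trans Pp) // (leq_trans (incr_ge aS p)).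
  move=> i j ij; rewrite /y; case: asboolP => // -[]; by exists p, n.
apply: DN; apply: (evadesI yx); exists 0%N => r i _ ir H0.
have ar : (a r <= (a r.+1).-1 < a r.+1)%N.
  by have := aS r; case: (a r.+1) => // q; rewrite /= !ltnS leqnn andbT.
have mj : maxn i (a r.+1).-1 = (a r.+1).-1.
  by apply/maxn_idPr; apply: leq_trans ir _; apply: leq_trans (incr_ge aS r) _; case/andP: ar.
have := H0 _ ar; rewrite /y mj; case: asboolP => // -[q [n [aq /andP[kn nk] ka]]].
have qr : q = r.
  by rewrite -(blockE aS ar) (@blockE a q) // (leq_trans aq kn) (ltn_trans nk ka).
by move: ka; rewrite qr ltnNge -(ltn_predK (aS r)) nk.
Qed.

Definition mat (M : seq (seq bool)) i j := nth false (nth [::] M i) j.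

Definition mat_of (z : nat -> nat -> bool) b := mkseq (fun i => mkseq (z i) b) b.

Lemma mat_ofE z b i j : (maxn i j < b)%N -> mat (mat_of z b) i j = z i j.
Proof. by rewrite gtn_max => /andP[ib jb]; rewrite /mat /mat_of !nth_mkseq. Qed.

Definition guess (y : nat -> nat -> bool) m : nat :=
  if @unpickle (nat * nat)%type m is Some (i, u) then run (y i) u else 0%N.

Lemma guessE y (i u : nat) : guess y (pickle (i, u)) = run (y i) u.
Proof. by rewrite /guess pickleK. Qed.

(** A guess in block r comes from a row i <= r, so its index is bounded before the value to be
    guessed there is chosen. *)
Definition guess_bound (r u : nat) : nat := (\max_(i < r.+1) pickle (i : nat, u) + r)%N.

Lemma guess_bound_ge (r u i : nat) : (i <= r)%N -> (pickle (i, u) <= guess_bound r u)%N.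
Proof.
rewrite -ltnS => ir; apply: leq_trans (leq_addr _ _).
exact: (@leq_bigmax _ (fun i : 'I_r.+1 => pickle (i : nat, u)) (Ordinal ir)).
Qed.

Lemma pickle_unbounded P : exists B, forall i u : nat, (B <= u)%N -> (P <= pickle (i, u))%N.
Proof.
pose s m := if @unpickle (nat * nat)%type m is Some iu then iu.2 else 0%N.
exists (\max_(m < P) s m).+1 => i u Bu; rewrite leqNgt; apply/negP => mP.
have := @leq_bigmax _ (fun m : 'I_P => s m) (Ordinal mP).
by rewrite /= /s pickleK /= leqNgt Bu.
Qed.

(* The [m]-th guess [f m] proposes a content [M] for any of the positions in a
   list [L]; the first one not yet assigned is retained.  There is one as soon as
   [L] has more than [m] elements ([assigned_guess]). *)
Definition assignment := seq (nat * seq (seq bool)).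

Definition assign_step (T : assignment) c : assignment :=
  if @unpickle (seq nat * seq (seq bool))%type c is Some (L, M) then
    if [seq p <- L | p \notin unzip1 T] is p :: _ then (p, M) :: T else T
  else T.

Fixpoint assign (f : nat -> nat) m : assignment :=
  if m is q.+1 then assign_step (assign f q) (f q) else [::].

Definition assigned f p : seq (seq bool) :=
  xget [::] [set M | exists m, (p, M) \in assign f m].

Lemma assign_uniq f m : uniq (unzip1 (assign f m)).
Proof.
elim: m => //= m IH; rewrite /assign_step; case: (unpickle (f m)) => [[L M]|//].
case E: (seq.filter _ _) => [//|p s] /=; rewrite IH andbT.
have : p \in [seq p <- L | p \notin unzip1 (assign f m)] by rewrite E inE eqxx.
by rewrite mem_filter => /andP[].
Qed.

Lemma assign_size f m : (size (assign f m) <= m)%N.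
Proof.
elim: m => //= m IH; rewrite /assign_step; case: (unpickle (f m)) => [[L M]|]; last exact: leqW.
by case: (seq.filter _ _) => [|p s] /=; rewrite ?ltnS //; exact: leqW.
Qed.

Lemma assign_sub f m n : (m <= n)%N -> {subset assign f m <= assign f n}.
Proof.
elim: n => [|n IH]; first by rewrite leqn0 => /eqP ->.
rewrite leq_eqVlt => /orP[/eqP ->//|/IH mn] x /mn /=.
rewrite /assign_step; case: (unpickle (f n)) => [[L M]|//].
by case: (seq.filter _ _) => // p s; rewrite inE => ->; rewrite orbT.
Qed.

Lemma assigned_eq f p M m : (p, M) \in assign f m -> assigned f p = M.
Proof.
move=> pM; have : exists M, [set M | exists m, (p, M) \in assign f m] M by exists M, m.
move=> /(xgetPex [::]); rewrite -/(assigned f p) => -[m' pM'].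
have k1 := assign_sub (leq_maxl m m') pM; have k2 := assign_sub (leq_maxr m m') pM'.
have := assign_uniq f (maxn m m') => un.
have h1 := index_mem; apply/esym.
have := nth_index (p, M) k1; have := nth_index (p, M) k2.
set T := assign f _ in k1 k2 un *; set i1 := index (p, M) T; set i2 := index _ T => e2 e1.
have i12 : i1 = i2.
  apply/eqP; rewrite -(nth_uniq p _ _ un) ?size_map ?index_mem //.
  by rewrite !(nth_map (p, M)) ?index_mem // e1 e2.
by move: e2; rewrite -i12 e1 => -[].
Qed.

Lemma assigned_guess f m L M : f m = pickle (L, M) -> uniq L -> (m < size L)%N ->
  exists2 p, p \in L & assigned f p = M.
Proof.
move=> fm uL mL.
have E : assign f m.+1 = assign_step (assign f m) (f m) by [].
move: E; rewrite /assign_step fm pickleK.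
case F: (seq.filter _ _) => [|p s] E.
  have : {subset L <= unzip1 (assign f m)}.
    move=> p pL; apply: contraT => pn.
    have : p \in [seq p <- L | p \notin unzip1 (assign f m)] by rewrite mem_filter pn.
    by rewrite F.
  move=> /(uniq_leq_size uL); rewrite size_map leqNgt.
  by rewrite (leq_ltn_trans (assign_size f m) mL).
exists p; last by apply: (@assigned_eq _ _ _ m.+1); rewrite E inE eqxx.
have : p \in [seq p <- L | p \notin unzip1 (assign f m)] by rewrite F inE eqxx.
by rewrite mem_filter => /andP[].
Qed.

Lemma infinite_list (X : nat -> Prop) : (forall P, exists2 p, (P <= p)%N & X p) ->
  forall P n, exists L B, [/\ uniq L, size L = n &
    forall p, p \in L -> [/\ (P <= p)%N, (p < B)%N & X p]].
Proof.
move=> H P; elim=> [|n [L [B [uL sL LP]]]]; first by exists [::], 0%N.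
have [q Bq Xq] := H (maxn B P); move: Bq; rewrite geq_max => /andP[Bq Pq].
exists (q :: L), q.+1; split; first 1 last.
- by rewrite /= sL.
- move=> p; rewrite inE => /orP[/eqP ->//|/LP[Pp pB Xp]]; split => //.
  by rewrite ltnS (leq_trans (ltnW pB)).
- by rewrite /= uL andbT; apply/negP => /LP[_ + _]; rewrite ltnNge Bq.
Qed.

Definition fusion (y1 y2 : nat -> nat -> bool) : nat -> nat -> bool :=
  assemble (orbit_of (fun u => \max_(i < u.+1) run (y1 i) u))
    (fun p => mat (assigned (guess y2) p)).

(* Bartoszynski's argument for non(M): [x1] determines an interval partition.
   Unless the intervals of [x1] are dominated by those of a code of [N],
   infinitely many contain an interval of the code, and [x2] only has to guess
   the code on infinitely many of these. *)
Lemma combine_exists : exists psi : Q -> Q -> Q, forall N, meager N ->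
  exists D, sC0 D /\ forall x1, D x1 \/
    exists E, sC0 E /\ forall x2, N (psi x1 x2) -> E x2.
Proof.
have [cd cdP] := choice (@code_exists R); have [dc dcP] := choice (@codes_exists R).
exists (fun x1 x2 => dc (fusion (cd x1) (cd x2))) => N /meager_code[k [z [kS kz]]].
(* One more than the bound of [contains_or_dominated]: guessing [H] infinitely often refutes
   domination. *)
pose H u := (k (k u.+1).+1).+1.
exists (misguesses (fun _ u => H u)); split; first exact: misguesses_sigma.
move=> x1; set F := fun u => \max_(i < u.+1) run (cd x1 i) u.
pose a := orbit_of F; have aS : forall n, (a n < a n.+1)%N by exact: orbit_of_incr.
have [X|[M FM]] := contains_or_dominated F kS; last first.
  left; apply: contrapT => nD.
  have [r [i [Mr ir rE]]] := not_misguesses (cdP x1) nD M.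
  set u := guess_seq _ r in rE; have ru : (r <= u)%N by exact: incr_ge (guess_seq_incr _) r.
  have := FM u (leq_trans Mr ru); rewrite leqNgt => /negP; apply.
  have iu : (i < u.+1)%N by rewrite ltnS (leq_trans ir).
  apply: leq_trans (@leq_bigmax _ (fun i : 'I_u.+1 => run (cd x1 i) u) (Ordinal iu)).
  by rewrite /= rE /H.
right; have XL := infinite_list X.
(* The value to guess lists more good intervals than the index of the guess, so that one of them is
   still free, with a piece of [z] that covers them all. *)
have /choice[c cP] (ru : nat * nat) : exists c : nat, exists L B,
    [/\ c = pickle (L, mat_of z (a B)), uniq L, (guess_bound ru.1 ru.2 < size L)%N &
     forall p, p \in L -> [/\ (ru.1 <= p)%N, (p < B)%N &
       exists n, (a p <= k n)%N && (k n.+1 < a p.+1)%N]].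
  have [L [B [uL sL LP]]] := XL ru.1 (guess_bound ru.1 ru.2).+1.
  by exists (pickle (L, mat_of z (a B))), L, B; split; rewrite ?sL.
exists (misguesses (fun r u => c (r, u))); split; first exact: misguesses_sigma.
move=> x2; apply: contraPP => nE; apply: (kz _ _ (dcP _)) => P.
have [r [i [Pr ir]]] := not_misguesses (cdP x2) nE (k P).
set u := guess_seq _ r; rewrite -guessE.
have [L [B [-> uL sL LP]]] := cP (r, u) => gE.
have [p pL pE] := assigned_guess gE uL (leq_ltn_trans (guess_bound_ge u ir) sL).
have [/= rp pB [n /andP[an na]]] := LP p pL; exists n.
  rewrite leqNgt; apply/negP => /(incr_lt kS); rewrite ltnNge.
  by rewrite (leq_trans Pr) // (leq_trans rp) // (leq_trans (incr_ge aS p)).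
move=> s t /andP[st ts].
have -> : fusion (cd x1) (cd x2) s t = mat (assigned (guess (cd x2)) p) s t.
  by apply: (@assemble_agree a _ p aS); rewrite (leq_trans an st) (ltn_trans ts na).
rewrite pE; apply: mat_ofE; apply: leq_trans ts _; apply: leq_trans (ltnW na) _.
exact: (@incr_le a aS p.+1 B pB).
Qed.

Definition hitbox (w : nat -> nat -> bool) a b : set Q :=
  [set x | exists2 y, agree a b y w & box y b x].

Definition avoider w (d : nat -> nat) : set Q :=
  [set x | exists M, forall q, (M <= q)%N -> ~ hitbox w (d q) (d q.+1) x].

(** A converse of [meager_code]: any finite part of a code can be continued by [w] on a whole later
    shell. *)
Lemma avoider_meager w d : (forall n, d n < d n.+1)%N -> meager (avoider w d).
Proof.
move=> dS; pose A M : set Q := \bigcap_(q in [set q | (M <= q)%N]) ~` hitbox w (d q) (d q.+1).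
exists A; last first.
  apply/seteqP; split => x; first by move=> [M HM]; exists M.
  by move=> [M _ HM]; exists M.
move=> M; have clA : closed (A M).
  apply: closed_bigI => q _; apply: open_closedC.
  have -> : hitbox w (d q) (d q.+1) = \bigcup_(y in [set y | agree (d q) (d q.+1) y w]) box y (d q.+1).
    by apply/seteqP; split => x [y ? ?]; exists y.
  by apply: bigcup_open => y _; exact: box_open.
rewrite /nowhere_dense -((closure_id _).1 clA) -subset0 => x; rewrite /interior => xA.
have [y yx] := code_exists x; have [l lP] := codes_nbhs xA yx.
pose q := maxn M l; have lq : (l <= d q)%N.
  by apply: leq_trans (incr_ge dS q); exact: leq_maxr.
pose y' i j := if (maxn i j < d q)%N then y i j else w i j.
have [v vb] := box_nonempty R y' (d q.+1); have [z zv] := code_exists v.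
have zy := box_codes vb zv.
have : A M v.
  apply: (lP v z zv) => i j /andP[_ ij].
  have ijq : (maxn i j < d q)%N by exact: leq_trans ij lq.
  by rewrite zy ?(ltn_trans ijq) // /y' ijq.
move=> /(_ q) /=; rewrite leq_maxl => /(_ isT); apply.
by exists y' => // i j /andP[h1 h2]; rewrite /y' ltnNge h1.
Qed.

(* The argument of Truss and Miller for add(M) = min(b, cov(M)) and dually for
   cof(M): [k1] bounds the intervals of a code of [A], [x] guesses the code
   infinitely often, and [k2] bounds the distance between good guesses. *)
Lemma truss : exists Phi : (nat -> nat) -> Q -> (nat -> nat) -> set Q,
  (forall k1 x k2, meager (Phi k1 x k2)) /\
  forall A, meager A -> exists h1, forall k1, dominated h1 k1 ->
    exists E, sC0 E /\ forall x, ~ E x ->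
      exists h2, forall k2, dominated h2 k2 -> A `<=` Phi k1 x k2.
Proof.
have [cd cdP] := choice (@code_exists R).
pose W k1 x := assemble (orbit_of k1)
  (fun p => mat (odflt [::] (@unpickle (seq (seq bool)) (guess (cd x) p)))).
exists (fun k1 x k2 => avoider (W k1 x) (orbit_of k1 \o orbit_of k2)); split.
  move=> k1 x k2; apply: avoider_meager => n.
  exact: (incr_lt (orbit_of_incr k1) (orbit_of_incr k2 n)).
move=> A /meager_code[k [z [kS kz]]]; exists (fun m => k m.+1) => k1 [M1 k1P].
pose d := orbit_of k1; have dS : forall n, (d n < d n.+1)%N by exact: orbit_of_incr.
have dk p : (M1 <= p)%N -> exists n, (d p <= k n)%N && (k n.+1 <= d p.+1)%N.
  move=> Mp; exists (d p); rewrite (incr_ge kS) /=.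
  apply: leq_trans (k1P _ (leq_trans Mp (incr_ge dS p))) _.
  exact/ltnW/envelope_ge.
(* Guess number p is the content of shell p. The piece of [z] reaches beyond that shell for every
   row that block r can use. *)
exists (misguesses (fun r u => pickle (mat_of z (d (guess_bound r u).+1)))); split.
  exact: misguesses_sigma.
move=> x nE.
have good P : exists2 p, (P <= p)%N & agree (d p) (d p.+1) (W k1 x) z.
  have [B BP] := pickle_unbounded P.
  have [r [i [Br ir]]] := not_misguesses (cdP x) nE B.
  set u := guess_seq _ r; rewrite -guessE => gE.
  exists (pickle (i, u)).
    apply: BP; apply: leq_trans Br _; exact: incr_ge (guess_seq_incr _) r.
  set p := pickle (i, u) in gE *; move=> s t st.
  rewrite [LHS](@assemble_agree d _ p dS) // gE pickleK /=; apply: mat_ofE.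
  move: st => /andP[_ st]; apply: leq_trans st _; 
  exact: (@incr_le d dS p.+1 (guess_bound r u).+1 (guess_bound_ge u ir)).
have /choice[g gP] : forall P, exists p, (P <= p)%N /\ agree (d p) (d p.+1) (W k1 x) z.
  by move=> P; have [p ? ?] := good P; exists p.
exists g => k2 [M2 k2P] x' Ax'.
pose e := orbit_of k2; have eS : forall n, (e n < e n.+1)%N by exact: orbit_of_incr.
apply: contrapT => nP; apply: (kz x' (cd x') (cdP x')) Ax' => P.
pose M := maxn (maxn M1 M2) (k P).
have [q Mq [y yW yb]] : exists2 q, (M <= q)%N & hitbox (W k1 x) (d (e q)) (d (e q.+1)) x'.
  apply: contrapT => H; apply: nP; exists M => q Mq hq; apply: H; by exists q.
have yx := box_codes yb (cdP x').
move: Mq; rewrite !geq_max => /andP[/andP[M1q M2q] kPq].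
have qe : (q <= e q)%N := incr_ge eS q.
(* The good shell p lies between [e q] and [e q.+1], so an agreement with [W] on the large shell
   includes an agreement with [z] on shell p. *)
have [ep pg] := gP (e q); set p := g (e q) in ep pg.
have pe : (p < e q.+1)%N.
  exact: leq_ltn_trans (k2P _ (leq_trans M2q qe)) (envelope_ge k2 (e q)).
have [n /andP[dn nd]] := dk p (leq_trans M1q (leq_trans qe ep)).
have dpe : (d p.+1 <= d (e q.+1))%N by exact: (incr_le dS pe).
exists n.
  rewrite leqNgt; apply/negP => /(incr_lt kS); rewrite ltnNge.
  by rewrite (leq_trans kPq) // (leq_trans qe) // (leq_trans ep) // (leq_trans (incr_ge dS p)).
move=> i j /andP[ij ji]; have jp := leq_trans ji nd.
rewrite yx ?(leq_trans jp) // yW ?pg ?(leq_trans dn ij) //.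
by rewrite (leq_trans jp) // andbT (leq_trans _ (leq_trans dn ij)) //; exact: (incr_le dS ep).
Qed.

End guess_sets.

(** * Squares of infinite sets *)

Lemma card_le_inj (T U : Type) (X : set T) (Y : set U) (u0 : U) : X #<= Y ->
  exists f : T -> U, (forall x, X x -> Y (f x)) /\
    forall x x', X x -> X x' -> f x = f x' -> x = x'.
Proof.
move=> /card_leP/unsquash f.
exists (fun x => if pselect (X x) is left h then set_val (f (exist _ x (mem_set h))) else u0).
split=> [x Xx|x x' Xx Xx']; first by case: pselect => // h; exact: set_valP.
case: pselect => // h; case: pselect => // h' /val_inj /(@inj _ _ _ f).
by rewrite !inE => /(_ I I) /(congr1 set_val).
Qed.

Section squares.
Variable T : Type.
Implicit Types A X Y Z : set T.

Lemma card_le_surj X Y y0 : Y #<= X -> Y y0 ->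
  exists g : T -> T, (forall x, X x -> Y (g x)) /\
    forall y, Y y -> exists2 x, X x & g x = y.
Proof.
move=> /(card_le_inj y0)[f [fX fI]] Yy0.
have /choice[g gP] x : exists y, Y y /\ forall y', Y y' -> f y' = x -> y' = y.
  have [[y [Yy fy]]|n] := pselect (exists y, Y y /\ f y = x).
    by exists y; split => // y' Yy' fy'; apply: fI => //; rewrite fy' fy.
  by exists y0; split => // y' Yy' fy'; case: n; exists y'.
exists g; split=> [x _|y Yy]; first by case: (gP x).
exists (f y); first exact: fX.
by have [_ /(_ y Yy erefl)] := gP (f y).
Qed.

(** Comparability is the existence of a least cardinality among the two sets. *)
Lemma card_le_or X Y : X #<= Y \/ Y #<= X.
Proof.
have [|+ H2] := @min_cardP T [set Z | Z = X \/ Z = Y]; first by exists X; left.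
by move=> [E|E]; rewrite E in H2; [left; apply: H2; right|right; apply: H2; left].
Qed.

(* [G] is the graph of a map from a subset [X] of [A] onto [X * X]. *)
Definition squaring (G : set (T * (T * T))) (A : set T) :=
  let X := [set c | exists ab, G (c, ab)] in
  [/\ X `<=` A, forall c a b, G (c, (a, b)) -> X a /\ X b,
      forall a b, X a -> X b -> exists c, G (c, (a, b)) &
      forall c ab ab', G (c, ab) -> G (c, ab') -> ab = ab'].

(** Joining [G0] to every graph keeps the maximal one above the starting graph, and settles the
    empty chain. *)
Lemma squaring_chain A G0 (F : set (set (T * (T * T)))) :
  squaring G0 A -> (forall G, F G -> squaring (G0 `|` G) A) -> total_on F subset ->
  squaring (G0 `|` \bigcup_(G in F) G) A.
Proof.
move=> G0s Fs Ft; have [[G1 FG1]|noF] := pselect (exists G, F G); last first.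
  rewrite (_ : \bigcup_(G in F) G = set0) ?setU0 //.
  by apply/seteqP; split => // x [G FG]; case: noF; exists G.
have up G p : F G -> (G0 `|` G) p -> (G0 `|` \bigcup_(G in F) G) p.
  by move=> FG [Gp|Gp]; [left|right; exists G].
have dn p : (G0 `|` \bigcup_(G in F) G) p -> exists2 G, F G & (G0 `|` G) p.
  by move=> [Gp|[G FG Gp]]; [exists G1 => //; left|exists G => //; right].
have dn2 p q : (G0 `|` \bigcup_(G in F) G) p -> (G0 `|` \bigcup_(G in F) G) q ->
    exists2 G, F G & (G0 `|` G) p /\ (G0 `|` G) q.
  move=> /dn[G FG Gp] /dn[H FH Hq]; have [GH|HG] := Ft _ _ FG FH.
    by exists H => //; split => //; case: Gp => [|/GH]; [left|right].
  by exists G => //; split => //; case: Hq => [|/HG]; [left|right].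
split.
- move=> c [ab /dn[G FG Gc]]; have [h _ _ _] := Fs G FG; apply: h; by exists ab.
- move=> c a b /dn[G FG Gc]; have [_ h _ _] := Fs G FG.
  by have [[x xa] [y yb]] := h _ _ _ Gc; split; [exists x|exists y]; exact: up xa || exact: up yb.
- move=> a b [x xa] [y yb]; have [G FG [Gx Gy]] := dn2 _ _ xa yb.
  have [_ _ h _] := Fs G FG; have [||c cab] := h a b; [by exists x|by exists y|].
  by exists c; exact: up cab.
- move=> c ab ab' h1 h2; have [G FG [g1 g2]] := dn2 _ _ h1 h2.
  by have [_ _ _ h] := Fs G FG; exact: h g1 g2.
Qed.

(* If the domain [X] of a maximal [squaring] injects into its complement in
   [A], it extends to [X] and a disjoint copy [j @` X]: three disjoint fibres
   of the squaring of [X] enumerate the new part of the square. *)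
Lemma squaring_extend A G (X := [set c | exists ab, G (c, ab)]) (j : T -> T) x0 x1 x2 :
  squaring G A -> X x0 -> X x1 -> X x2 -> x0 <> x1 -> x0 <> x2 -> x1 <> x2 ->
  (forall x, X x -> A (j x) /\ ~ X (j x)) ->
  (forall x x', X x -> X x' -> j x = j x' -> x = x') ->
  exists2 H, squaring H A & G `<` H.
Proof.
move=> [XA GX XG Gf] X0 X1 X2 n01 n02 n12 jA jI.
pose new := [set p : T * (T * T) | exists c q s u v,
  [/\ p.1 = j c, G (c, (q, s)), G (s, (u, v)) &
    [\/ q = x0 /\ p.2 = (u, j v), q = x1 /\ p.2 = (j u, v) |
       [/\ q <> x0, q <> x1 & p.2 = (j u, j v)]]]].
exists (G `|` new); last first.
  split; first by move=> p Gp; left.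
  have [s Gs] := XG _ _ X0 X0; have Xs : X s by exists (x0, x0).
  have [c Gc] := XG _ _ X0 Xs; move=> sub.
  have Xc : X c by exists (x0, s).
  have /sub : (G `|` new) (j c, (x0, j x0)).
    by right; exists c, x0, s, x0, x0; split => //; apply: Or31.
  by move=> Gj; have [_ []] := jA c Xc; exists (x0, j x0).
pose XH := [set c | exists ab, (G `|` new) (c, ab)].
have newj c q s u v ab : G (c, (q, s)) -> G (s, (u, v)) ->
    [\/ q = x0 /\ ab = (u, j v), q = x1 /\ ab = (j u, v) |
       [/\ q <> x0, q <> x1 & ab = (j u, j v)]] -> (G `|` new) (j c, ab).
  by move=> Gc Gs H; right; exists c, q, s, u, v.
have domX c : X c -> XH c by move=> [ab Gc]; exists ab; left.
have domj c : X c -> XH (j c).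
  move=> [[q s] Gc]; have [_ [[u v] Gs]] := GX _ _ _ Gc.
  have [q0|q0] := pselect (q = x0); first by exists (u, j v); apply: newj Gc Gs _; apply: Or31.
  have [q1|q1] := pselect (q = x1); first by exists (j u, v); apply: newj Gc Gs _; apply: Or32.
  by exists (j u, j v); apply: newj Gc Gs _; apply: Or33.
have dom c : XH c -> X c \/ exists2 d, X d & c = j d.
  move=> [ab [Gc|[d [q [s [u [v [/= -> Gd _ _]]]]]]]]; first by left; exists ab.
  by right; exists d => //; exists (q, s).
have cover u v q : X u -> X v -> X q -> exists c s, G (c, (q, s)) /\ G (s, (u, v)).
  move=> Xu Xv Xq; have [s Gs] := XG _ _ Xu Xv.
  have [c Gc] := XG _ _ Xq (ex_intro _ (u, v) Gs : X s); by exists c, s.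
split.
- by move=> c /dom[/XA//|[d Xd ->]]; case: (jA d Xd).
- move=> c a b [/GX[Xa Xb]|[d [q [s [u [v [/= _ _ /GX[Xu Xv] H]]]]]]].
    by split; exact: domX.
  by case: H => [[_ [-> ->]]|[_ [-> ->]]|[_ _ [-> ->]]]; split; exact: domX || exact: domj.
- move=> a b /dom[Xa|[u Xu ->]] /dom[Xb|[v Xv ->]].
  + by have [c Gc] := XG _ _ Xa Xb; exists c; left.
  + have [c [s [Gc Gs]]] := cover _ _ _ Xa Xv X0.
    by exists (j c); apply: newj Gc Gs _; apply: Or31.
  + have [c [s [Gc Gs]]] := cover _ _ _ Xu Xb X1.
    by exists (j c); apply: newj Gc Gs _; apply: Or32.
  + have [c [s [Gc Gs]]] := cover _ _ _ Xu Xv X2.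
    by exists (j c); apply: newj Gc Gs _; apply: Or33; split => //; exact: nesym.
- move=> c ab ab' [Gc|[d [q [s [u [v [/= cE Gd Gs H]]]]]]] [Gc'|[d' [q' [s' [u' [v' [/= cE' Gd' Gs' H']]]]]]].
  + exact: Gf Gc Gc'.
  + by have [_ []] := jA d' (ex_intro _ _ Gd'); rewrite -cE'; exists ab.
  + by have [_ []] := jA d (ex_intro _ _ Gd); rewrite -cE; exists ab'.
  + have dd : d = d'.
      by apply: jI; [exists (q, s)|exists (q', s')|rewrite -cE -cE'].
    rewrite -dd in Gd'; have [qq ss] := Gf _ _ _ Gd Gd'; rewrite -qq -ss in Gs' H'.
    have [uu vv] := Gf _ _ _ Gs Gs'; rewrite -uu -vv in H'.
    case: H => [[q0 ->]|[q0 ->]|[q0 q1 ->]]; case: H' => [[r0 ->]|[r0 ->]|[r0 r1 ->]] //.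
    * by case: n01; rewrite -q0.
    * by case: n01; rewrite -q0.
Qed.

(** Let X be the domain of a maximal squaring extending one on a countable subset. By
    [squaring_extend], X does not inject into its complement in [A], so that complement is empty or
    an image of X; thus [A] is an image of two copies of X, hence of X. *)
Lemma infinite_square A : infinite_set A -> exists g1 g2 : T -> T,
  forall a b, A a -> A b -> exists c, [/\ A c, g1 c = a & g2 c = b].
Proof.
move=> infA.
have [a0 Aa0] := infinite_setN0 infA.
have nA : exists i : nat -> T, injective i /\ forall n, A (i n).
  have /infiniteP/(card_le_inj a0)[i [iA iI]] := infA.
  by exists i; split => [m n|n]; [exact: iI|exact: iA].
have [i [iI iA]] := nA.
pose dec k := odflt (0, 0)%N (@unpickle (nat * nat)%type k).
pose G0 := [set p : T * (T * T) | exists k, p = (i k, (i (dec k).1, i (dec k).2))].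
have G0s : squaring G0 A.
  have iX m : exists ab, G0 (i m, ab) by exists (i (dec m).1, i (dec m).2), m.
  split.
  - by move=> c [ab [k [-> _]]].
  - by move=> c a b [k [_ -> ->]]; split; exact: iX.
  - move=> _ _ [_ [m [-> _]]] [_ [n [-> _]]]; exists (i (pickle (m, n))), (pickle (m, n)).
    by rewrite /dec pickleK.
  - by move=> _ ab ab' [k [-> ->]] [k' [/iI <- ->]].
have [G1 [G1s Gmax]] := @Zorn_bigcup _ (fun G => squaring (G0 `|` G) A)
  (fun F FP Ft => squaring_chain G0s FP Ft).
set G := G0 `|` G1 in G1s; pose X := [set c | exists ab, G (c, ab)].
have iX n : X (i n) by exists (i (dec n).1, i (dec n).2); left; exists n.
have [XA GX XG Gf] := G1s.
have Xle : ~ (exists j : T -> T, (forall x, X x -> A (j x) /\ ~ X (j x)) /\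
    forall x x', X x -> X x' -> j x = j x' -> x = x').
  move=> [j [jA jI]].
  have [H Hs [GH nHG]] := squaring_extend G1s (iX 0%N) (iX 1%N) (iX 2%N)
    ltac:(by move=> /iI) ltac:(by move=> /iI) ltac:(by move=> /iI) jA jI.
  apply: (Gmax H); last by rewrite (_ : G0 `|` H = H) //; apply/setUidr => p Gp; apply: GH; left.
  split; first by move=> p Gp; apply: GH; right.
  by move=> HG1; apply: nHG => p /HG1 Gp; right.
have [f fP] : exists f : T -> T * T, forall a b, X a -> X b -> exists2 c, X c & f c = (a, b).
  have /choice[f fG] c : exists ab, X c -> G (c, ab).
    by have [[ab Gc]|n] := pselect (X c); [exists ab|exists (c, c)].
  exists f => a b Xa Xb; have [c Gc] := XG a b Xa Xb; have Xc : X c by exists (a, b).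
  by exists c => //; exact: Gf (fG c Xc) Gc.
have [phi phiP] : exists phi : T -> T, forall a, A a -> exists2 x, X x & phi x = a.
  have [AX|nAX] := pselect (A `<=` X); first by exists id => a /AX; exists a.
  have [y0 [Ay0 nXy0]] : exists y, A y /\ ~ X y.
    by apply: contrapT => H; apply: nAX => a Aa; apply: contrapT => nXa; apply: H; exists a.
  have [XY|YX] := card_le_or X (A `\` X).
    by have [j [jA jI]] := card_le_inj y0 XY; case: Xle; exists j; split => // x /jA.
  have [g [gY gS]] := card_le_surj YX (conj Ay0 nXy0 : (A `\` X) y0).
  (* The first component is a tag: [i 0] means that the second is taken in X itself, any other value
     that it goes through [g] to the complement. *)
  exists (fun c => if pselect ((f c).1 = i 0%N) then (f c).2 else g (f c).2) => a Aa.
  have [Xa|nXa] := pselect (X a).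
    have [c Xc fc] := fP _ _ (iX 0%N) Xa; exists c => //.
    by case: pselect; rewrite fc.
  have [x Xx gx] := gS a (conj Aa nXa); have [c Xc fc] := fP _ _ (iX 1%N) Xx.
  by exists c => //; case: pselect; rewrite fc //= => /iI.
exists (fun c => phi (f c).1), (fun c => phi (f c).2) => a b Aa Ab.
have [x Xx <-] := phiP a Aa; have [y Xy <-] := phiP b Ab.
by have [c Xc fc] := fP x y Xx Xy; exists c; rewrite fc; split => //; exact: XA.
Qed.

End squares.

(** * The cardinal characteristics *)

Section ideals.
Variable R : realType.
Local Notation Q := (hilbert_cube R).
Local Notation M := (@meager Q).
Local Notation sC0 := (sigma_ideal (@minimal_cantor_set R)).

Lemma nowhere_denseS (T : topologicalType) (A B : set T) :
  A `<=` B -> nowhere_dense B -> nowhere_dense A.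
Proof.
rewrite /nowhere_dense -!subset0 => AB H.
exact: subset_trans (interiorS (closureS AB)) H.
Qed.

Lemma meagerS (T : topologicalType) (A B : set T) : A `<=` B -> meager B -> meager A.
Proof.
move=> AB [F ndF BE]; exists (fun n => A `&` F n).
  by move=> n; apply: nowhere_denseS (ndF n) => x [].
by rewrite -setI_bigcupr -BE; apply/esym/setIidl.
Qed.

Lemma sigma_idealS (T : Type) (F : set (set T)) (A B : set T) :
  A `<=` B -> sigma_ideal F B -> sigma_ideal F A.
Proof. by move=> AB [G FG BG]; exists G => //; exact: subset_trans AB BG. Qed.

Lemma minimal_nowhere_dense (A : set Q) : minimal_cantor_set A -> nowhere_dense A.
Proof.
(* The test set is {0,1}^omega: it has no interior, since setting one far coordinate to 1/2 leaves
   it. *)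
pose K (_ : nat) : set R := [set 0; 1].
pose B : set Q := [set x | forall n, K n (coord x n)].
have Bmin : minimal_cantor_set B.
  apply: minimal_cantor_product.
  - by move=> n; apply: closedU; exact: closed_eq.
  - by move=> n t [->|->]; rewrite /= in_itv /=; lra.
  - by move=> n; left.
  - by move=> n; right.
  - move=> n a b a0 ab b1; exists ((a + b) / 2); split; first by lra.
    by move=> [/= h|/= h]; lra.
have clB : closed B.
  have -> : B = \bigcap_(n in setT) ((fun x : Q => coord x n) @^-1` K n).
    by apply/seteqP; split => x H n => [_|]; exact: H.
  apply: closed_bigI => n _; apply: preimage_closed.
    by move=> x _; exact: coord_continuous.
  by apply: closedU; exact: closed_eq.
move=> [_ /(_ B Bmin.1)[h [ch [g [cg hK gK]]] hAB]].
have clA : closure A `<=` h @^-1` B.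
  have cl : closed (h @^-1` B) by apply: preimage_closed => // x _; exact: ch.
  rewrite [X in _ `<=` X]((closure_id _).1 cl); apply: closureS.
  by move=> x Ax; apply: hAB; exists x.
rewrite /nowhere_dense -subset0 => x xA.
have : nbhs (h x) B.
  have gA : nbhs (h x) (g @^-1` closure A) by apply: cg; rewrite hK.
  by apply: filterS gA => y gy; rewrite -(gK y); exact: clA.
move=> /cube_nbhs[N [e [e0 H]]].
pose v n : R := if (n < N)%N then coord (h x) n else 2^-1.
have v01 n : 0 <= v n <= 1 by rewrite /v; case: ifP => _; [exact: coord_itv|lra].
have Bv : B (mk v) by apply: H => n nN; rewrite coord_mk // /v nN subrr normr0.
by have := Bv N; rewrite coord_mk // /v ltnn => -[/= E|/= E]; lra.
Qed.

Lemma sigma_meager (A : set Q) : sC0 A -> M A.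
Proof.
move=> [G [/countable_injP[f fI] GF] AG].
exists (fun n => A `&` \bigcup_(B in [set B | G B /\ f B = n]) B).
  move=> n; have [[B [GB fB]]|nB] := pselect (exists B, G B /\ f B = n).
    apply: nowhere_denseS (minimal_nowhere_dense (GF B GB)) => x [_ [C [GC fC] Cx]].
    by rewrite (fI B C) ?inE // fB fC.
  rewrite (_ : _ `&` _ = set0); last first.
    by rewrite -subset0 => x [_ [B [GB fB] _]]; apply: nB; exists B.
  by rewrite /nowhere_dense closure0 interior0.
apply/seteqP; split => [x Ax|x [n _ []//]].
have [B GB Bx] := AG x Ax; exists (f B) => //; split => //.
by exists B.
Qed.

Lemma cube_not_meager : ~ M setT.
Proof.
move=> /meager_code[k [z [kS kz]]]; have [x zx] := codes_exists R z.
by apply: (kz x z zx) => // P; exists P.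
Qed.

(** A code differs from its complement at every digit, so the point evades the complement with
    blocks of length 1. *)
Lemma point_in_minimal (x : Q) : exists2 A : set Q, minimal_cantor_set A & A x.
Proof.
have [y yx] := code_exists x.
have : evades id (fun i j => ~~ y i j) x.
  apply: (evadesI yx); exists 0%N => r i _ _ /(_ r); rewrite leqnn ltnSn => /(_ isT).
  by case: (y i r).
have [G [_ GF] H /H[A GA Ax]] := @evades_sigma R id (fun i j => ~~ y i j) ltnSn.
by exists A => //; exact: GF.
Qed.

Lemma countable_sigma (A : set Q) : countable A -> sC0 A.
Proof.
move=> cA; have /choice[c cP] x : exists B : set Q, minimal_cantor_set B /\ B x.
  by have [B mB Bx] := point_in_minimal x; exists B.
exists (c @` A).
  split; first exact: card_le_trans (card_image_le c A) cA.
  by move=> _ [x _ <-]; exact: (cP x).1.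
by move=> x Ax; exists (c x); [exists x|exact: (cP x).2].
Qed.

Lemma sigma_infinite (A : set Q) : ~ sC0 A -> infinite_set A.
Proof. by move=> nA /finite_set_countable/countable_sigma. Qed.

Lemma sigma_cover : \bigcup_(A in sC0) A = [set: Q].
Proof.
apply/seteqP; split => // x _; exists [set x] => //.
by apply: countable_sigma; exact: finite_set_countable.
Qed.

End ideals.

Theorem theorem1p5 (R : realType) :
  let M := @meager (hilbert_cube R) in
  let sC0 := sigma_ideal (@minimal_cantor_set R) in
  [/\ ideal_cov sC0 #= ideal_cov M,
      ideal_non sC0 #= ideal_non M,
      ideal_add2 sC0 M #= ideal_add M &
      ideal_cof2 sC0 M #= ideal_cof M].
Proof.
move=> M sC0; set Q := hilbert_cube R.
have sM : sC0 `<=` M by move=> A; exact: sigma_meager.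
have nT := @cube_not_meager R.
have MU (F : set (set Q)) : \bigcup_(A in F) A = [set: Q] -> ~ M (\bigcup_(A in F) A) by move=> ->.
have covT := @sigma_cover R.
have [psi psiP] := combine_exists R.
have [D [sD DP]] := dominating_family R.
have [Phi [mPhi PhiP]] := truss R.
have MT : \bigcup_(A in M) A = [set: Q].
  by rewrite -subTset -covT; exact: bigcup_subset.
split.
- have [[cM cMT] cMmin] := @min_cardP _ [set F | F `<=` M /\ \bigcup_(A in F) A = [set: Q]]
    (ex_intro _ M (conj (fun _ => id) MT)).
  have [[cS cST] cSmin] := @min_cardP _ [set F | F `<=` sC0 /\ \bigcup_(A in F) A = [set: Q]]
    (ex_intro _ sC0 (conj (fun _ => id) covT)).
  rewrite /ideal_cov; set FM := min_card _ in cM cMT cMmin *; set FS := min_card _ in cS cST cSmin *.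
  rewrite card_eq_le; apply/andP; split; last first.
    by apply: cMmin; split => // A /cS /sM.
  (* Either the sets [d N] cover the cube, or a point [x1] outside all of them yields sets [e N]
     that do, since every [psi x1 x] lies in some N. *)
  have /choice[d dP] N : exists d : set Q, FM N -> sC0 d /\
      forall x1, d x1 \/ exists E, sC0 E /\ forall x2, N (psi x1 x2) -> E x2.
    have [FN|nF] := pselect (FM N); last by exists set0.
    by have [d dP] := psiP N (cM N FN); exists d.
  have [dT|/existsNP[x1 nx1]] := pselect (forall x1, exists2 N, FM N & d N x1).
    apply: card_le_trans (card_image_le d FM); apply: cSmin; split.
      by move=> _ [N FN <-]; exact: (dP N FN).1.
    apply/seteqP; split => // x _; have [N FN dx] := dT x.
    by exists (d N) => //; exists N.
  have /choice[e eP] N : exists e : set Q, FM N -> sC0 e /\ forall x2, N (psi x1 x2) -> e x2.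
    have [FN|nF] := pselect (FM N); last by exists set0.
    have [_ /(_ x1)[dx|[e eP]]] := dP N FN; last by exists e.
    by case: nx1; exists N.
  apply: card_le_trans (card_image_le e FM); apply: cSmin; split.
    by move=> _ [N FN <-]; exact: (eP N FN).1.
  apply/seteqP; split => // x _.
  have [N FN Nx] : (\bigcup_(A in FM) A) (psi x1 x) by rewrite cMT.
  by exists (e N); [exists N|exact: (eP N FN).2].
- have [nM nMmin] := @min_cardP _ [set A : set Q | ~ M A] (ex_intro _ setT nT).
  have [|nS nSmin] := @min_cardP _ [set A : set Q | ~ sC0 A].
    by exists setT => /sM.
  rewrite /ideal_non; set AM := min_card _ in nM nMmin *; set AS := min_card _ in nS nSmin *.
  rewrite card_eq_le; apply/andP; split.
    by apply: nSmin => /sM.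
  (* The witness is the image under [psi] of all pairs from [AS]; as [AS] is infinite, [AS] itself
     can index them. *)
  have [g1 [g2 gP]] := infinite_square (sigma_infinite nS).
  apply: card_le_trans (card_image_le (fun c => psi (g1 c) (g2 c)) AS); apply: nMmin.
  move=> /psiP[d [sd dP]]; apply: nS.
  have [Ad|/existsNP[x1 /not_implyP[Ax1 nd]]] := pselect (forall x, AS x -> d x).
    exact: sigma_idealS Ad sd.
  have [//|[E [sE EP]]] := dP x1.
  apply: sigma_idealS sE => x2 Ax2; apply: EP.
  by have [c [Ac <- <-]] := gP x1 x2 Ax1 Ax2; exists c.
- have [[aM aMn] aMmin] := @min_cardP _ [set F | F `<=` M /\ ~ M (\bigcup_(A in F) A)]
    (ex_intro _ M (conj (fun _ => id) (MU M MT))).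
  have [[aS aSn] aSmin] := @min_cardP _ [set F | F `<=` sC0 /\ ~ M (\bigcup_(A in F) A)]
    (ex_intro _ sC0 (conj (fun _ => id) (MU sC0 covT))).
  rewrite /ideal_add /ideal_add2; set FM := min_card _ in aM aMn aMmin *; set FS := min_card _ in aS aSn aSmin *.
  rewrite card_eq_le; apply/andP; split; last first.
    by apply: aMmin; split => // A /aS /sM.
  apply: contrapT => nle; apply: aMn.
  (* Otherwise [FS] would be at most as large as [FM]. Each round below, a bound, a point, a bound,
     is one use of this. *)
  have small (u : set Q -> set Q) : (forall A, FM A -> sC0 (u A)) ->
      M (\bigcup_(A in FM) u A).
    move=> us; apply: contrapT => nM; apply: nle.
    apply: card_le_trans (card_image_le u FM); apply: aSmin; split.
      by move=> _ [A FA <-]; exact: us.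
    by rewrite bigcup_image.
  have /choice[h1 h1P] A : exists h1, FM A -> forall k1, dominated h1 k1 ->
      exists E, sC0 E /\ forall x, ~ E x ->
      exists h2, forall k2, dominated h2 k2 -> A `<=` Phi k1 x k2.
    have [FA|nF] := pselect (FM A); last by exists id.
    by have [h hP] := PhiP A (aM A FA); exists h.
  have [k1 k1P] := DP _ (small (D \o h1) (fun A _ => sD (h1 A))).
  have k1d A : FM A -> dominated (h1 A) k1.
    by move=> FA; apply: k1P => x Dx; exists A.
  have /choice[E EP] A : exists E, FM A -> sC0 E /\ forall x, ~ E x ->
      exists h2, forall k2, dominated h2 k2 -> A `<=` Phi k1 x k2.
    have [FA|nF] := pselect (FM A); last by exists set0.
    by have [E EP] := h1P A FA k1 (k1d A FA); exists E.
  have ME := small E (fun A FA => (EP A FA).1).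
  have [x nx] : exists x, ~ (\bigcup_(A in FM) E A) x.
    apply: contrapT => /forallNP H; apply: nT; rewrite (_ : setT = \bigcup_(A in FM) E A) //.
    by apply/seteqP; split => // x _; apply: contrapT; exact: H.
  have /choice[h2 h2P] A : exists h2, FM A -> forall k2, dominated h2 k2 -> A `<=` Phi k1 x k2.
    have [FA|nF] := pselect (FM A); last by exists id.
    have [h hP] := (EP A FA).2 x (fun Ex => nx (ex_intro2 _ _ A FA Ex)).
    by exists h.
  have [k2 k2P] := DP _ (small (D \o h2) (fun A _ => sD (h2 A))).
  apply: meagerS (mPhi k1 x k2) => y [A FA Ay]; apply: (h2P A FA k2) Ay.
  by apply: k2P => z Dz; exists A.
- have [[cM cMc] cMmin] := @min_cardP _ [set F | F `<=` M /\
      forall B, M B -> exists2 A, F A & B `<=` A]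
    (ex_intro _ M (conj (fun _ => id) (fun B MB => ex_intro2 _ _ B MB (fun _ => id)))).
  have [[cS cSc] cSmin] := @min_cardP _ [set F | F `<=` M /\
      forall B, sC0 B -> exists2 A, F A & B `<=` A]
    (ex_intro _ M (conj (fun _ => id) (fun B sB => ex_intro2 _ _ B (sM B sB) (fun _ => id)))).
  rewrite /ideal_cof /ideal_cof2; set FM := min_card _ in cM cMc cMmin *; set FS := min_card _ in cS cSc cSmin *.
  rewrite card_eq_le; apply/andP; split.
    by apply: cSmin; split => // B /sM /cMc.
  have /choice[k kP] N : exists k, FS N -> forall h, D h `<=` N -> dominated h k.
    have [FN|nF] := pselect (FS N); last by exists id.
    by have [k kP] := DP N (cS N FN); exists k.
  have /choice[p pP] N : exists x : Q, FS N -> ~ N x.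
    have [FN|nF] := pselect (FS N); last by exists (mk (fun=> 0)).
    apply: contrapT => /forallNP H; apply: nT; rewrite (_ : setT = N); first exact: cS.
    by apply/esym/seteqP; split => // x _; apply: contrapT => nNx; apply: (H x).
  (* If [FS] were countable, the points [p N] would form a set in [sC0] contained in no member of
     [FS]. *)
  have infF : infinite_set FS.
    move=> /finite_set_countable cF.
    have /cSc[N FN pN] : sC0 (p @` FS).
      by apply: countable_sigma; exact: card_le_trans (card_image_le p FS) cF.
    by apply: (pP N FN); apply: pN; exists N.
  have [g1 [g2 gP]] := infinite_square infF.
  (* Each c encodes a triple of members of [FS], giving a first bound, a point and a second
     bound. *)
  pose u c := Phi (k (g1 c)) (p (g1 (g2 c))) (k (g2 (g2 c))).
  apply: card_le_trans (card_image_le u FS); apply: cMmin; split.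
    by move=> _ [c _ <-]; exact: mPhi.
  move=> B /PhiP[h1 h1P]; have [N1 F1 DN1] := cSc _ (sD h1).
  have [E [sE EP]] := h1P _ (kP N1 F1 h1 DN1); have [N2 F2 EN2] := cSc _ sE.
  have [h2 h2P] := EP (p N2) (fun Ep => pP N2 F2 (EN2 _ Ep)).
  have [N3 F3 DN3] := cSc _ (sD h2).
  have [c' [Fc' c1 c2]] := gP N2 N3 F2 F3; have [c [Fc c3 c4]] := gP N1 c' F1 Fc'.
  exists (u c); first by exists c.
  by rewrite /u c4 c3 c1 c2; apply: h2P; exact: kP.
Qed.
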